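(* For dimension $n\le 4$, there is, up to isomorphism, at most one Hopf algebra over $\mathbb{F}_2$ of any given algebra-coalgebra type. That is, if $H,H'$ are Hopf algebras over $\mathbb{F}_2$ of the same dimension $n\le 4$ such that $H\cong H'$ as algebras and $H\cong H'$ as coalgebras, then $H\cong H'$ as Hopf algebras.
   Context: A finite-dimensional bialgebra $H$ has algebra-coalgebra type $(X,Y^* )$, for algebras $X$ and $Y$, if $H\cong X$ as an algebra and $H$ is isomorphic as a coalgebra to the dual coalgebra of $Y$. The algebra isomorphism and the coalgebra isomorphism in this notion need not be the same map. Isomorphisms of Hopf algebras are linear bijections that are both algebra and coalgebra maps. *)

(* Defs.v *)
Set Warnings "-notation-overridden,-ambiguous-paths,-redundant-canonical-projection".
From HB Require Import structures.
From mathcomp Require Import all_boot all_order all_algebra all_field.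

Set Implicit Arguments.
Unset Strict Implicit.
Unset Printing Implicit Defensive.

Import GRing.Theory.
Local Open Scope ring_scope.

Section Coordinates.
Variables (F : fieldType) (V : vectType F).

Definition vbas (i : 'I_(\dim {:V})) : V := (vbasis {:V})`_i.

Definition vcoord (i : 'I_(\dim {:V})) : V -> F^o := coord (vbasis {:V}) i.

Fact vcoord_is_linear i : linear (vcoord i).
Proof. exact: linearP. Qed.

HB.instance Definition _ i :=
  GRing.isLinear.Build F V F^o *:%R (vcoord i) (vcoord_is_linear i).

Lemma vcoordK v : \sum_i vcoord i v *: vbas i = v.
Proof. by rewrite [RHS](coord_vbasis (memvf v)). Qed.

Lemma vcoord_bas i j : vcoord i (vbas j) = (i == j)%:R.
Proof. by rewrite /vcoord /vbas coord_free 1?eq_sym ?(basis_free (vbasisP _)). Qed.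

End Coordinates.

(* The tensor product is represented by coefficient matrices relative to the
   basis vbas of each factor; tens_liftE and tens_ext give its universal
   property.  The alias hides the matrix product. *)
Definition tensor (F : fieldType) (U V : vectType F) : Type :=
  'M[F]_(\dim {:U}, \dim {:V}).

HB.instance Definition _ (F : fieldType) (U V : vectType F) :=
  Vector.copy (tensor U V) 'M[F]_(\dim {:U}, \dim {:V}).

Definition tens (F : fieldType) (U V : vectType F) (u : U) (v : V) :
  tensor U V := \matrix_(i, j) (vcoord i u * vcoord j v).

Definition tens_lift (F : fieldType) (U V W : vectType F) (f : U -> V -> W)
    (t : tensor U V) : W :=
  \sum_i \sum_j (t : 'M[F]_(_, _)) i j *: f (vbas i) (vbas j).

Section TensorTheory.
Variables (F : fieldType) (U V : vectType F).

Lemma tens_linearr (u : U) : linear (tens u : V -> tensor U V).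
Proof.
by move=> a x y; apply/matrixP=> i j; rewrite !mxE linearP /= mulrDr mulrCA.
Qed.

Lemma tens_linearl (v : V) : linear ((@tens F U V)^~ v).
Proof.
by move=> a x y; apply/matrixP=> i j; rewrite !mxE linearP /= mulrDl -mulrA.
Qed.

Lemma tens_suml I (r : seq I) (a : I -> F) (u : I -> U) (v : V) :
  tens (\sum_(i <- r) a i *: u i) v = \sum_(i <- r) a i *: tens (u i) v.
Proof.
pose tl := GRing.isLinear.Build _ _ _ _ ((@tens F U V)^~ v) (tens_linearl v).
pose tL : {linear U -> tensor U V} := HB.pack ((@tens F U V)^~ v) tl.
by rewrite -[LHS]/(tL _) linear_sum; apply: eq_bigr => i _; rewrite linearZ.
Qed.

Lemma tens_sumr I (r : seq I) (a : I -> F) (u : U) (v : I -> V) :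
  tens u (\sum_(i <- r) a i *: v i) = \sum_(i <- r) a i *: tens u (v i).
Proof.
pose tl := GRing.isLinear.Build _ _ _ _ (@tens F U V u) (tens_linearr u).
pose tL : {linear V -> tensor U V} := HB.pack (@tens F U V u) tl.
by rewrite -[LHS]/(tL _) linear_sum; apply: eq_bigr => i _; rewrite linearZ.
Qed.

Lemma tensor_sum (t : tensor U V) :
  t = \sum_i \sum_j (t : 'M[F]_(_, _)) i j *: tens (vbas i) (vbas j).
Proof.
rewrite [LHS](matrix_sum_delta (t : 'M_(_, _))).
apply: eq_bigr => i _; apply: eq_bigr => j _; congr (_ *: _).
apply/matrixP=> k l; rewrite !mxE !vcoord_bas.
by rewrite -natrM mulnb.
Qed.

Variable W : vectType F.

Fact tens_lift_is_linear (f : U -> V -> W) : linear (tens_lift f).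
Proof.
move=> a s t; rewrite /tens_lift scaler_sumr -big_split /=.
apply: eq_bigr => i _; rewrite scaler_sumr -big_split /=.
by apply: eq_bigr => j _; rewrite !mxE scalerDl scalerA.
Qed.

HB.instance Definition _ (f : U -> V -> W) :=
  GRing.isLinear.Build F (tensor U V) W *:%R (tens_lift f)
    (tens_lift_is_linear f).

Lemma tens_liftE (f : U -> V -> W) (u : U) (v : V) :
  (forall x, linear (f x)) -> (forall y, linear (f^~ y)) ->
  tens_lift f (tens u v) = f u v.
Proof.
move=> fr fl.
pose fRl x := GRing.isLinear.Build _ _ _ _ (f x) (fr x).
pose fLl y := GRing.isLinear.Build _ _ _ _ (f^~ y) (fl y).
pose fR x : {linear V -> W} := HB.pack (f x) (fRl x).
pose fL y : {linear U -> W} := HB.pack (f^~ y) (fLl y).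
rewrite -[RHS]/(fL v u) -[X in fL v X]vcoordK linear_sum.
apply: eq_bigr => i _; rewrite linearZ /= -[f _ v]/(fR (vbas i) v).
rewrite -[X in fR _ X]vcoordK linear_sum scaler_sumr.
by apply: eq_bigr => j _; rewrite linearZ mxE scalerA.
Qed.

Lemma tens_lift_linear_fun a (f g h : U -> V -> W) t :
  (forall u v, h u v = a *: f u v + g u v) ->
  tens_lift h t = a *: tens_lift f t + tens_lift g t.
Proof.
move=> hE; rewrite /tens_lift scaler_sumr -big_split; apply: eq_bigr => i _ /=.
rewrite scaler_sumr -big_split; apply: eq_bigr => j _ /=.
by rewrite hE scalerDr !scalerA [a * _]mulrC.
Qed.

Lemma tens_ext (f g : {linear tensor U V -> W}) :
  (forall u v, f (tens u v) = g (tens u v)) -> f =1 g.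
Proof.
move=> fg t; rewrite [t]tensor_sum !linear_sum; apply: eq_bigr => i _.
by rewrite !linear_sum; apply: eq_bigr => j _; rewrite !linearZ fg.
Qed.

End TensorTheory.

Section TensorMaps.
Variables (F : fieldType) (U V W U' V' : vectType F).

Definition tens_map (f : U -> U') (g : V -> V') : tensor U V -> tensor U' V' :=
  tens_lift (fun u v => tens (f u) (g v)).

HB.instance Definition _ (f : U -> U') (g : V -> V') :=
  GRing.isLinear.Build F (tensor U V) (tensor U' V') *:%R (tens_map f g)
    (tens_lift_is_linear _).

Lemma tens_mapE (f : {linear U -> U'}) (g : {linear V -> V'}) u v :
  tens_map f g (tens u v) = tens (f u) (g v).
Proof.
rewrite /tens_map tens_liftE // => [x a y z | y a x z].
  by rewrite linearP tens_linearr.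
by rewrite linearP tens_linearl.
Qed.

Definition tens_assoc : tensor (tensor U V) W -> tensor U (tensor V W) :=
  tens_lift (fun t w => tens_lift (fun u v => tens u (tens v w)) t).

HB.instance Definition _ :=
  GRing.isLinear.Build F (tensor (tensor U V) W) (tensor U (tensor V W)) *:%R
    tens_assoc (tens_lift_is_linear _).

Lemma tens_assocE u v w : tens_assoc (tens (tens u v) w) = tens u (tens v w).
Proof.
rewrite /tens_assoc tens_liftE => [|t a x y|y]; last exact: tens_lift_is_linear.
  rewrite tens_liftE // => [x a y z | y a x z]; last by rewrite tens_linearl.
  by rewrite tens_linearl tens_linearr.
by apply: tens_lift_linear_fun => u' v'; rewrite !tens_linearr.
Qed.

End TensorMaps.

Definition tens_mul (F : fieldType) (A B : falgType F) (s t : tensor A B) :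
    tensor A B :=
  tens_lift (fun a b => tens_lift (fun c d => tens (a * c) (b * d)) t) s.

Lemma tens_mulE (F : fieldType) (A B : falgType F) (a c : A) (b d : B) :
  tens_mul (tens a b) (tens c d) = tens (a * c) (b * d).
Proof.
rewrite /tens_mul tens_liftE => [|x k y z|x k y z].
- rewrite tens_liftE => [//|x k y z|x k y z].
    by rewrite mulrDr -scalerAr tens_linearr.
  by rewrite mulrDr -scalerAr tens_linearl.
- by apply: tens_lift_linear_fun => u v; rewrite mulrDl -scalerAl tens_linearr.
- by apply: tens_lift_linear_fun => u v; rewrite mulrDl -scalerAl tens_linearl.
Qed.

HB.mixin Record Vector_isCoalgebra (F : fieldType) C of Vector F C := {
  comul : C -> tensor C C;
  counit : C -> F;
  comul_linear : linear comul;
  counit_linear : linear (counit : C -> F^o);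
  comulA : forall c,
    tens_assoc (tens_map comul idfun (comul c)) = tens_map idfun comul (comul c);
  counitl : forall c, tens_lift (fun x y => counit x *: y) (comul c) = c;
  counitr : forall c, tens_lift (fun x y => counit y *: x) (comul c) = c
}.

#[short(type="coalgType")]
HB.structure Definition Coalgebra (F : fieldType) :=
  { C of Vector_isCoalgebra F C & Vector F C }.

HB.mixin Record Coalgebra_isBialgebra (F : fieldType) H
    of Falgebra F H & Coalgebra F H := {
  comulM : forall x y : H, comul (x * y) = tens_mul (comul x) (comul y);
  comul1 : comul (1 : H) = tens 1 1;
  counitM : forall x y : H, counit (x * y) = counit x * counit y;
  counit1 : counit (1 : H) = 1
}.

#[short(type="bialgType")]
HB.structure Definition Bialgebra (F : fieldType) :=
  { H of Coalgebra_isBialgebra F H & Falgebra F H & Coalgebra F H }.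

HB.mixin Record Bialgebra_isHopf (F : fieldType) H of Bialgebra F H := {
  antipode : H -> H;
  antipode_linear : linear antipode;
  antipodel : forall h : H,
    tens_lift (fun x y => antipode x * y) (comul h) = (counit h)%:A;
  antipoder : forall h : H,
    tens_lift (fun x y => x * antipode y) (comul h) = (counit h)%:A
}.

#[short(type="hopfAlgType")]
HB.structure Definition HopfAlgebra (F : fieldType) :=
  { H of Bialgebra_isHopf F H & Bialgebra F H }.

HB.instance Definition _ (F : fieldType) (C : coalgType F) :=
  GRing.isLinear.Build F C (tensor C C) *:%R comul comul_linear.

HB.instance Definition _ (F : fieldType) (C : coalgType F) :=
  GRing.isLinear.Build F C F^o *:%R (counit : C -> F^o) counit_linear.

HB.instance Definition _ (F : fieldType) (H : hopfAlgType F) :=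
  GRing.isLinear.Build F H H *:%R antipode antipode_linear.

Definition coalg_morphism (F : fieldType) (C D : coalgType F) (f : C -> D) :=
  (forall c, comul (f c) = tens_map f f (comul c)) /\
  (forall c, counit (f c) = counit c).

Definition alg_iso (F : fieldType) (A B : falgType F) :=
  exists f : {lrmorphism A -> B}, bijective f.

Definition coalg_iso (F : fieldType) (C D : coalgType F) :=
  exists f : {linear C -> D}, bijective f /\ coalg_morphism f.

Definition hopf_iso (F : fieldType) (H K : hopfAlgType F) :=
  exists f : {lrmorphism H -> K}, bijective f /\ coalg_morphism f.

(* Y^* as a vector space; comul and counit on it are the transposes of the
   multiplication and of the unit of Y (see dual_comulE). *)
Definition dual (F : fieldType) (Y : falgType F) : Type := 'Hom(Y, F^o).

HB.instance Definition _ (F : fieldType) (Y : falgType F) :=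
  Vector.copy (dual Y) 'Hom(Y, F^o).

Section Dual.
Variables (F : fieldType) (Y : falgType F).
Implicit Types f : dual Y.

Local Notation ev f := (fun_of_lfun (f : 'Hom(Y, F^o))).

Definition dbas (i : 'I_(\dim {:Y})) : dual Y := linfun (vcoord i).

Definition dual_comul f : tensor (dual Y) (dual Y) :=
  \sum_i \sum_j ev f (vbas i * vbas j) *: tens (dbas i) (dbas j).

Definition dual_counit f : F := ev f 1.

Lemma ev_dbas i y : ev (dbas i) y = vcoord i y.
Proof. by rewrite lfunE. Qed.

Lemma evZ f a y : ev f (a *: y) = a * ev f y.
Proof. exact: linearZ. Qed.

Lemma ev_mull f y z : \sum_i vcoord i y * ev f (vbas i * z) = ev f (y * z).
Proof.
rewrite -[in RHS](vcoordK y) mulr_suml linear_sum /=.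
by apply: eq_bigr => i _; rewrite -scalerAl linearZ.
Qed.

Lemma ev_mulr f y z : \sum_i vcoord i z * ev f (y * vbas i) = ev f (y * z).
Proof.
rewrite -[in RHS](vcoordK z) mulr_sumr linear_sum /=.
by apply: eq_bigr => i _; rewrite -scalerAr linearZ.
Qed.

Lemma dual_coords f y :
  \sum_i vcoord i y * ev f (vbas i) = ev f y.
Proof.
rewrite -[in RHS](vcoordK y) linear_sum /=.
by apply: eq_bigr => i _; rewrite linearZ.
Qed.

Lemma dual_sum f : \sum_i ev f (vbas i) *: dbas i = f.
Proof.
apply/lfunP=> y; rewrite sum_lfunE -(dual_coords f).
by apply: eq_bigr => i _; rewrite scale_lfunE ev_dbas [RHS]mulrC.
Qed.

Fact dual_comul_is_linear : linear dual_comul.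
Proof.
move=> a f g; rewrite /dual_comul scaler_sumr -big_split; apply: eq_bigr => i _.
rewrite scaler_sumr -big_split; apply: eq_bigr => j _ /=.
by rewrite add_lfunE scale_lfunE scalerDl scalerA.
Qed.

HB.instance Definition _ :=
  GRing.isLinear.Build F (dual Y) _ *:%R dual_comul dual_comul_is_linear.

Fact dual_counit_is_linear : linear (dual_counit : dual Y -> F^o).
Proof. by move=> a f g; rewrite /dual_counit add_lfunE scale_lfunE. Qed.

HB.instance Definition _ :=
  GRing.isLinear.Build F (dual Y) F^o *:%R (dual_counit : dual Y -> F^o)
    dual_counit_is_linear.

Lemma dual_comulE f y z :
  tens_lift (fun g h => (ev g y * ev h z : F^o)) (dual_comul f) = ev f (y * z).
Proof.
rewrite linear_sum -[in RHS](vcoordK y) mulr_suml linear_sum.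
apply: eq_bigr => i _; rewrite -scalerAl linearZ linear_sum /=.
rewrite -[in RHS](vcoordK z) mulr_sumr linear_sum scaler_sumr.
apply: eq_bigr => j _; rewrite linearZ /= tens_liftE => [|g a h k|h a g k].
- by rewrite !ev_dbas -scalerAr evZ /GRing.scale /= mulrA mulrC.
- by rewrite add_lfunE scale_lfunE mulrDr [LHS]addrC mulrCA addrC.
- by rewrite add_lfunE scale_lfunE mulrDl -mulrA.
Qed.

Fact dual_comulA f :
  tens_assoc (tens_map dual_comul idfun (dual_comul f))
    = tens_map idfun dual_comul (dual_comul f).
Proof.
have lhsE (g h : dual Y) : tens_assoc (tens (dual_comul g) h) =
    \sum_p ev g (vbas p.1 * vbas p.2) *:
      tens (dbas p.1) (tens (dbas p.2) h).
  rewrite /dual_comul pair_big tens_suml linear_sum.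
  by apply: eq_bigr => p _; rewrite linearZ /= tens_assocE.
have rhsE (g h : dual Y) : tens g (dual_comul h) =
    \sum_p ev h (vbas p.1 * vbas p.2) *:
      tens g (tens (dbas p.1) (dbas p.2)).
  by rewrite /dual_comul pair_big tens_sumr.
transitivity (\sum_p \sum_k ev f (vbas p.1 * vbas p.2 * vbas k)
   *: tens (dbas p.1) (tens (dbas p.2) (dbas k))).
  transitivity (\sum_k \sum_i \sum_p (ev f (vbas i * vbas k) *
      vcoord i (vbas p.1 * vbas p.2)) *:
      tens (dbas p.1) (tens (dbas p.2) (dbas k))).
    rewrite [dual_comul f]exchange_big (linear_sum (tens_map _ _)).
    rewrite (linear_sum (@tens_assoc F _ _ _)); apply: eq_bigr => k _.
    rewrite (linear_sum (tens_map _ _)) (linear_sum (@tens_assoc F _ _ _)).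
    apply: eq_bigr => i _.
    rewrite (linearZZ (tens_map _ _)) (linearZZ (@tens_assoc F _ _ _)) /=.
    rewrite tens_mapE lhsE scaler_sumr; apply: eq_bigr => p _.
    by rewrite scalerA ev_dbas.
  rewrite [RHS]exchange_big; apply: eq_bigr => k _.
  rewrite exchange_big; apply: eq_bigr => p _.
  rewrite -scaler_suml; congr (_ *: _).
  by rewrite -ev_mull; apply: eq_bigr => i _; rewrite mulrC.
rewrite -(pair_bigA _ (fun i j => \sum_k ev f (vbas i * vbas j * vbas k)
   *: tens (dbas i) (tens (dbas j) (dbas k)))) /=.
rewrite {2}/dual_comul (linear_sum (tens_map _ _)); apply: eq_bigr => i _.
rewrite (linear_sum (tens_map _ _)).
transitivity (\sum_j \sum_p (ev f (vbas i * vbas j) *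
    vcoord j (vbas p.1 * vbas p.2)) *:
    tens (dbas i) (tens (dbas p.1) (dbas p.2))); last first.
  apply: eq_bigr => j _; rewrite (linearZZ (tens_map _ _)) /= tens_mapE rhsE scaler_sumr.
  by apply: eq_bigr => p _; rewrite scalerA ev_dbas.
rewrite pair_big exchange_big; apply: eq_bigr => p _ /=.
rewrite -scaler_suml; congr (_ *: _).
by rewrite -mulrA -ev_mulr; apply: eq_bigr => j _; rewrite mulrC.
Qed.

Fact dual_counitl f :
  tens_lift (fun x y => dual_counit x *: y) (dual_comul f) = f.
Proof.
rewrite [dual_comul f]exchange_big linear_sum -[RHS](dual_sum f).
apply: eq_bigr => j _; rewrite linear_sum /=.
transitivity (\sum_i (ev f (vbas i * vbas j) * vcoord i 1) *: dbas j).
  apply: eq_bigr => i _; rewrite linearZ /= tens_liftE => [|g|h].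
  - by rewrite scalerA /dual_counit ev_dbas.
  - by move=> a x y; rewrite scalerDr !scalerA mulrC.
  - by move=> a x y; rewrite linearP scalerDl scalerA.
rewrite -scaler_suml; congr (_ *: _).
rewrite -[vbas j in RHS]mul1r -ev_mull.
by apply: eq_bigr => i _; rewrite mulrC.
Qed.

Fact dual_counitr f :
  tens_lift (fun x y => dual_counit y *: x) (dual_comul f) = f.
Proof.
rewrite linear_sum -[RHS](dual_sum f); apply: eq_bigr => i _.
rewrite linear_sum /=.
transitivity (\sum_j (ev f (vbas i * vbas j) * vcoord j 1) *: dbas i).
  apply: eq_bigr => j _; rewrite linearZ /= tens_liftE => [|h|g].
  - by rewrite scalerA /dual_counit ev_dbas.
  - by move=> a x y; rewrite linearP scalerDl scalerA.
  - by move=> a x y; rewrite scalerDr !scalerA mulrC.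
rewrite -scaler_suml; congr (_ *: _).
rewrite -[vbas i in RHS]mulr1 -ev_mulr.
by apply: eq_bigr => j _; rewrite mulrC.
Qed.

HB.instance Definition _ :=
  Vector_isCoalgebra.Build F (dual Y) dual_comul_is_linear
    dual_counit_is_linear dual_comulA dual_counitl dual_counitr.

End Dual.

Definition has_algcoalg_type (F : fieldType) (H : bialgType F)
    (X Y : falgType F) :=
  alg_iso H X /\ coalg_iso H (dual Y).

(* Main.v *)
(** In a basis [X_0 = 1, X_1, ..., X_d] of [H] whose dual basis starts with the
    counit, multiplication and comultiplication are two tables of structure
    constants over F_2, each of them a unital associative augmented algebra.

    An algebra isomorphism [H -> H'] need not preserve the counit, but the
    translation [h |-> \sum chi h_1 *: h_2] by a character [chi] is an algebra
    automorphism taking [chi] to the counit; dually, multiplication by the inverse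
    of a grouplike element is a coalgebra automorphism taking it to 1.  Hence [H]
    and [H'] have adapted bases with the same multiplication table [m], and others
    with the same comultiplication table [n].  It remains to see that all
    comultiplications on [m] in the [GL_d]-orbit of [n] that make it a Hopf algebra
    are conjugate under the stabilizer of [m].

    For [d <= 3] this is a finite computation, kept small by letting [m] and [n]
    range over normal forms: associative tables that are lexicographically minimal
    under the involutions of [GL_d] and homogeneous, i.e. isomorphic to their
    translates by all characters. *)
Require Import Defs.
From HB Require Import structures.
From mathcomp Require Import all_boot all_order all_algebra all_field zify.

Set Implicit Arguments.
Unset Strict Implicit.
Unset Printing Implicit Defensive.

Import GRing.Theory.

(** * Polynomial systems over F_2 *)

(* Index 0 is reserved for the unit and the counit. *)
Definition idx (d : nat) : seq nat := iota 0 d.+1.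
Arguments idx : simpl never.

Inductive expr := Cst of bool | Var of nat | Add of expr & expr | Mul of expr & expr.

(** Constant folding: an expression whose variables have all been substituted is literally a [Cst],
    which [specialize] recognizes. *)
Definition eadd e f :=
  match e, f with
  | Cst false, _ => f
  | _, Cst false => e
  | Cst true, Cst true => Cst false
  | _, _ => Add e f
  end.

Definition emul e f :=
  match e, f with
  | Cst false, _ | _, Cst false => Cst false
  | Cst true, _ => f
  | _, Cst true => e
  | _, _ => Mul e f
  end.

Fixpoint ev (v : seq bool) e :=
  match e with
  | Cst b => b
  | Var n => nth false v n
  | Add e f => ev v e (+) ev v f
  | Mul e f => ev v e && ev v f
  end.

(* Variable 0 is eliminated and the others are renumbered. *)
Fixpoint subst b e :=
  match e with
  | Cst c => Cst c
  | Var n => if n is n'.+1 then Var n' else Cst b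
  | Add e f => eadd (subst b e) (subst b f)
  | Mul e f => emul (subst b e) (subst b f)
  end.

(* The polynomials are to vanish: [None] signals a contradiction. *)
Fixpoint specialize b ps : option (seq expr) :=
  if ps is p :: ps' then
    match subst b p with
    | Cst true => None
    | Cst false => specialize b ps'
    | q => omap (cons q) (specialize b ps')
    end
  else Some [::].

(** Depth-first search over the variables; a branch is cut as soon as one polynomial folds to 1. *)
Fixpoint solve n ps : seq (seq bool) :=
  if n is n'.+1 then
    let branch b :=
      if specialize b ps is Some qs then [seq b :: s | s <- solve n' qs] else [::] in
    branch false ++ branch true
  else [:: [::]].

Definition esum := foldr eadd (Cst false).
Definition xsum := foldr addb false.

Lemma ev_add v e f : ev v (eadd e f) = ev v e (+) ev v f.
Proof. by case: e f => [[]|n|e1 e2|e1 e2] [[]|n'|f1 f2|f1 f2] //=; rewrite ?addbF. Qed.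

Lemma ev_mul v e f : ev v (emul e f) = ev v e && ev v f.
Proof. by case: e f => [[]|n|e1 e2|e1 e2] [[]|n'|f1 f2|f1 f2] //=; rewrite ?andbT ?andbF. Qed.

Lemma ev_sum v es : ev v (esum es) = xsum [seq ev v e | e <- es].
Proof. by elim: es => //= e es <-; rewrite ev_add. Qed.

Lemma ev_subst b v e : ev v (subst b e) = ev (b :: v) e.
Proof.
elim: e => [c|[|n]|e1 IH1 e2 IH2|e1 IH1 e2 IH2] //=.
  by rewrite ev_add IH1 IH2.
by rewrite ev_mul IH1 IH2.
Qed.

Lemma specializeP b v ps : all (fun p => ~~ ev (b :: v) p) ps ->
  exists2 qs, specialize b ps = Some qs & all (fun p => ~~ ev v p) qs.
Proof.
elim: ps => [|p ps IH] /=; first by exists [::].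
rewrite -ev_subst => /andP[pv /IH[qs -> qsv]].
by case: (subst b p) pv => [[]|n|e f|e f] //= pv; eexists; rewrite //= ?pv.
Qed.

(** A polynomial vanishing at [v] cannot fold to 1 along the branch of [v], so this branch survives
    every specialization. *)
Lemma mem_solve v ps : all (fun p => ~~ ev v p) ps -> v \in solve (size v) ps.
Proof.
elim: v ps => [|b v IH] ps //= /specializeP[qs psE /IH v_qs].
by rewrite mem_cat; case: b psE => ->; rewrite map_f ?orbT.
Qed.

(** * Normal forms of tables *)

(* Unlike [all] and [has], these stop early under [vm_compute], where the
   arguments of [&&] and [||] are strict. *)
Fixpoint every (T : Type) (p : pred T) s :=
  if s is x :: s' then if p x then every p s' else false else true.

Fixpoint some (T : Type) (p : pred T) s :=
  if s is x :: s' then if p x then true else some p s' else false.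

Lemma everyE (T : Type) (p : pred T) s : every p s = all p s.
Proof. by elim: s => //= x s ->. Qed.

Lemma someE (T : Type) (p : pred T) s : some p s = has p s.
Proof. by elim: s => //= x s ->. Qed.

Section Tables.
Variable d : nat.
Local Notation pos := (iota 1 d).
Local Notation pairs := [seq (a, b) | a <- idx d, b <- idx d].
Implicit Types (g h : nat -> nat -> bool) (t : nat -> nat -> nat -> bool).

Definition table := seq (seq (seq bool)).
Definition entry (t : table) i j k := nth false (nth [::] (nth [::] t i) j) k.
Definition coef (g : seq (seq bool)) i j := nth false (nth [::] g i) j.

Definition tab1 (f : nat -> bool) := [seq f k | k <- idx d].
Definition tab2 f := [seq tab1 (f j) | j <- idx d].
Definition tab3 f := [seq tab2 (f i) | i <- idx d].

(** The traversal starts from the top index: entries at index 0 coincide in all unital tables, so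
    differences show up sooner. *)
Definition agree1 (f f' : nat -> bool) := every (fun k => ~~ (f k (+) f' k)) (rev (idx d)).
Definition agree2 f f' := every (fun j => agree1 (f j) (f' j)) (rev (idx d)).
Definition agree3 f f' := every (fun i => agree2 (f i) (f' i)) (rev (idx d)).

Definition support_of (p : nat -> bool) := [seq a <- idx d | p a].

(* Structure constants in the basis [\sum_a g i a X_a], where [h] is the inverse of
   [g].  The same code runs on booleans and on symbolic entries; the [let]s share the
   supports of the rows. *)
Definition rebase T (op : T -> T -> T) o g h (t : nat -> nat -> nat -> T) i :=
  let A := support_of (g i) in fun j =>
  let B := [seq (a, b) | a <- A, b <- support_of (g j)] in fun k =>
  foldr op o [seq t ab.1 ab.2 c | ab <- B, c <- support_of (h^~ k)].

Definition xrebase := rebase addb false.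

Definition inverse_pair g h := agree2 (fun i k => xsum [seq g i a && h a k | a <- idx d])
  (fun i k => i == k).

(** The row condition fixes the unit [X_0]; the column condition, applied to the inverse matrix,
    fixes the counit. *)
Definition pointed g := agree1 (g 0) (eq_op 0) && agree1 (g^~ 0) (eq_op 0).

Definition base_change g h :=
  [&& inverse_pair g h, inverse_pair h g, pointed g & pointed h].

Definition is_character (a : nat -> bool) t :=
  agree2 (fun i j => a i && a j) (fun i j => xsum [seq a k && t i j k | k <- idx d]).

(* The new basis starts with the unit, and the first new dual vector is multiplicative,
   but it need not be the old augmentation. *)
Definition admissible g h t :=
  [&& inverse_pair g h, inverse_pair h g, agree1 (g 0) (eq_op 0) & is_character (h^~ 0) t].

(* The entries involving index 0 are fixed by the unit and the augmentation. *)
Definition tvar i j k :=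
  match i, j, k with
  | i'.+1, j'.+1, k'.+1 => Var ((i' * d + j') * d + k')
  | _.+1, _.+1, 0 => Cst false
  | 0, _, _ => Cst (j == k)
  | _, 0, _ => Cst (i == k)
  end.

(** The offset [o] keeps the entries of a matrix and of its inverse in disjoint blocks of variables;
    row and column 0 are forced by [pointed]. *)
Definition mvar o i j :=
  match i, j with
  | i'.+1, j'.+1 => Var (o + (i' * d + j'))
  | _, _ => Cst (i == j)
  end.

Definition inverse_polys :=
  [seq eadd (Cst (i == k)) (esum [seq emul (mvar 0 i a) (mvar (d * d) a k) | a <- idx d])
  | i <- pos, k <- pos].

(** The polynomials express [g h = 1] alone; the filter certifies each listed pair as a two-sided
    base change. *)
Definition GL : seq (seq (seq bool) * seq (seq bool)) :=
  [seq gh <- [seq (tab2 (fun i j => ev s (mvar 0 i j)), tab2 (fun i j => ev s (mvar (d * d) i j)))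
             | s <- solve (d * d + d * d) inverse_polys]
  | base_change (coef gh.1) (coef gh.2)].

(** The inner sums may start at [a = 1] because [t i j 0] vanishes for positive [i] and [j]. *)
Definition assoc_polys :=
  flatten [seq [seq eadd (esum [seq emul (tvar i j a) (tvar a k l) | a <- pos])
                         (esum [seq emul (tvar j k a) (tvar i a l) | a <- pos])
               | k <- pos, l <- pos] | i <- pos, j <- pos].

(** Evaluates to 1 exactly when, for lists of equal length, the first strictly precedes the second:
    the leading bits are 0 and 1, or they agree and the tails compare. The two cases exclude each
    other, so addition acts as disjunction. *)
Fixpoint lex_lt (xs ys : seq expr) :=
  match xs, ys with
  | x :: xs', y :: ys' =>
    eadd (emul (eadd (Cst true) x) y)
         (emul (eadd (Cst true) (eadd x y)) (lex_lt xs' ys'))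
  | _, _ => Cst false
  end.

Definition code T (t : nat -> nat -> nat -> T) :=
  flatten [seq [seq t i j k | k <- pos] | i <- pos, j <- pos].

(* A table that is minimal in its orbit satisfies these; only involutions are used, as
   they suffice to leave few tables. *)
Definition lex_polys G :=
  [seq lex_lt (code (rebase eadd (Cst false) (coef gh.1) (coef gh.2) tvar)) (code tvar)
  | gh <- [seq gh <- G | gh.1 == gh.2]].

Definition minimal_tables G :=
  [seq tab3 (fun i j k => ev s (tvar i j k))
  | s <- solve (d * d * d) (assoc_polys ++ lex_polys G)].

(** Matrix of the change [X_i |-> X_i + a_i 1] for positive [i], which makes the functional with
    values [a_i] the new augmentation. When [a_0 = 1] it fixes [X_0] and is an involution over F_2,
    hence serves as its own inverse. *)
Definition shift (a : seq bool) i j := if j is 0 then nth false a i else i == j.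

(* Table-level form of the translations by characters; this discards most algebras that
   carry no Hopf structure. *)
Definition homogeneous G (m : table) :=
  all (fun a => let m' := entry (tab3 (xrebase (shift a) (shift a) (entry m))) in
         some (fun gh => agree3 (xrebase (coef gh.1) (coef gh.2) (entry m)) m') G)
      [seq a <- [seq true :: s | s <- solve d [::]]
      | admissible (shift a) (shift a) (entry m)].

Definition normal_forms G := [seq m <- minimal_tables G | homogeneous G m].

Definition dedup :=
  foldr (fun (t : table) r =>
    if some (fun u : table => agree3 (entry t) (entry u)) r then r else t :: r) [::].

Definition orbit G n :=
  dedup [seq tab3 (xrebase (coef gh.1) (coef gh.2) (entry n)) | gh <- G].

(* As a comultiplication table, [entry c i j k] is the coefficient of [X_i (x) X_j] in the
   coproduct of [X_k]. *)
Definition cosupport c k := [seq ab <- pairs | entry c ab.1 ab.2 k].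
Definition with_cosupports c := (c, [seq cosupport c k | k <- idx d]).

(** The coefficient of [X_p (x) X_q] in the identity Delta(X_i X_j) = Delta(X_i) Delta(X_j). *)
Definition compatible_at (m : table) (c : table * seq (seq (nat * nat))) i j p q :=
  ~~ (xsum [seq entry m i j k && entry c.1 p q k | k <- idx d] (+)
      xsum [seq entry m ab.1 ce.1 p && entry m ab.2 ce.2 q
           | ab <- nth [::] c.2 i, ce <- nth [::] c.2 j]).

(* The first line is redundant; it rejects most incompatible tables early. *)
Definition compatible m c :=
  if every (fun i => every (fun j => compatible_at m c i j i j) (rev pos)) pos then
    every (fun p => every (fun q => every (fun i => every (fun j =>
      compatible_at m c i j p q) (rev pos)) pos) pos) pos
  else false.

(* Variable [i * d.+1 + a] is the coefficient of [X_a] in the antipode of [X_i]. *)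
Definition antipode_polys m (c : table * seq (seq (nat * nat))) :=
  [seq eadd (Cst ((k == 0) && (p == 0)))
     (esum [seq Var (ij.1 * d.+1 + a)
           | ij <- nth [::] c.2 k, a <- support_of (fun a => entry m a ij.2 p)])
  | k <- idx d, p <- idx d].

Definition has_antipode m c := solve (d.+1 * d.+1) (antipode_polys m c) != [::].

(** The filters are staged so that the antipode system is solved for compatible candidates only. *)
Definition hopf_comuls m O :=
  [seq c.1 | c <- [seq c <- [seq c <- O | compatible m c] | has_antipode m c]].

(* A change of basis acts on comultiplication tables contragrediently. *)
Definition conjugate_to S c0 c :=
  some (fun gh => agree3 (xrebase (fun i j => coef gh.2 j i) (fun i j => coef gh.1 j i) (entry c))
                        (entry c0)) S.

(** The orbits [Os] are shared by all [m]. Under the stabilizer [S] of [m], every Hopf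
    comultiplication in an orbit is compared with the first one found; an empty list passes, so the
    default of [head] never matters. *)
Definition rigid :=
  let G := GL in
  let M := normal_forms G in
  let Os := [seq [seq with_cosupports c | c <- orbit G n] | n <- M] in
  all (fun m =>
    let S := [seq gh <- G | agree3 (xrebase (coef gh.1) (coef gh.2) (entry m)) (entry m)] in
    all (fun O => let C := hopf_comuls m O in all (conjugate_to S (head [::] C)) C) Os) M.

End Tables.

(** * Completeness of the table enumerations *)

Lemma all_allpairs S T R (p : pred R) (f : S -> T -> R) s t :
  all p [seq f x y | x <- s, y <- t] = all (fun x => all (fun y => p (f x y)) t) s.
Proof. by elim: s => //= x s <-; rewrite all_cat all_map. Qed.

Lemma all_flatten (T : Type) (p : pred T) ss : all p (flatten ss) = all (all p) ss.
Proof. by elim: ss => //= s ss <-; rewrite all_cat. Qed.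

Section TableTheory.
Variable d : nat.
Implicit Types (g h : nat -> nat -> bool) (t u : nat -> nat -> nat -> bool).

Lemma mem_idx i : (i \in idx d) = (i <= d).
Proof. by rewrite mem_iota ltnS. Qed.

Lemma agree1P (f f' : nat -> bool) : reflect {in idx d, f =1 f'} (agree1 d f f').
Proof.
by rewrite /agree1 everyE all_rev; apply: (iffP allP) => E k /E; rewrite negb_add => /eqP.
Qed.

Lemma agree2P g h : reflect {in idx d &, g =2 h} (agree2 d g h).
Proof.
rewrite /agree2 everyE all_rev; apply: (iffP allP) => [E j k jd kd | E j jd].
  by have /agree1P-> := E j jd.
by apply/agree1P => k; apply: E.
Qed.

Lemma agree3P t u : reflect {in idx d & &, forall i j k, t i j k = u i j k} (agree3 d t u).
Proof.
rewrite /agree3 everyE all_rev; apply: (iffP allP) => [E i j k id jd kd | E i id].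
  by have /agree2P-> := E i id.
by apply/agree2P => j k; apply: E.
Qed.

Lemma nth_tab (T : Type) (x : T) (f : nat -> T) k : k \in idx d ->
  nth x [seq f k | k <- idx d] k = f k.
Proof.
by rewrite mem_idx => kd; rewrite (nth_map 0) ?size_iota // nth_iota.
Qed.

Lemma coef_tab2 g : {in idx d &, coef (tab2 d g) =2 g}.
Proof. by move=> i j id jd; rewrite /coef !nth_tab. Qed.

Lemma entry_tab3 t : {in idx d & &, forall i j k, entry (tab3 d t) i j k = t i j k}.
Proof. by move=> i j k id jd kd; rewrite /entry !nth_tab. Qed.

Lemma xsumE (s : seq bool) : xsum s = \big[addb/false]_(b <- s) b.
Proof. exact: foldrE. Qed.

Lemma eq_xsum (I : eqType) (r : seq I) (f f' : I -> bool) : {in r, f =1 f'} ->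
  xsum [seq f i | i <- r] = xsum [seq f' i | i <- r].
Proof. by move=> /eq_in_map->. Qed.

(** Restricting the sums to supports drops only zero terms. *)
Lemma xrebaseE g h t i j k : xrebase d g h t i j k =
  \big[addb/false]_(a <- idx d) \big[addb/false]_(b <- idx d) \big[addb/false]_(c <- idx d)
    [&& g i a, g j b, h c k & t a b c].
Proof.
rewrite /xrebase /rebase foldrE big_allpairs_dep /= big_allpairs_dep /= big_filter big_mkcond.
apply: eq_bigr => a _; case: (g i a); last first.
  by rewrite [RHS]big1 // => b _; rewrite big1.
rewrite big_filter big_mkcond; apply: eq_bigr => b _; case: (g j b); last by rewrite [RHS]big1.
by rewrite big_filter big_mkcond; apply: eq_bigr => c _; case: (h c k).
Qed.

Lemma eq_xrebase g g' h h' t u : {in idx d &, g =2 g'} -> {in idx d &, h =2 h'} ->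
  {in idx d & &, forall i j k, t i j k = u i j k} ->
  {in idx d & &, forall i j k, xrebase d g h t i j k = xrebase d g' h' u i j k}.
Proof.
move=> eg eh et i j k id jd kd; rewrite !xrebaseE.
apply: eq_big_seq => a ad; apply: eq_big_seq => b bd; apply: eq_big_seq => c cd.
by rewrite eg // eg // eh // et.
Qed.

Lemma eq_inverse_pair g g' h h' : {in idx d &, g =2 g'} -> {in idx d &, h =2 h'} ->
  inverse_pair d g h = inverse_pair d g' h'.
Proof.
move=> eg eh; apply/agree2P/agree2P => E i k id kd; rewrite -E //;
  apply: eq_xsum => a ad; by rewrite eg ?eh.
Qed.

Lemma eq_pointed g g' : {in idx d &, g =2 g'} -> pointed d g = pointed d g'.
Proof.
have d0 : 0 \in idx d by rewrite mem_idx.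
by move=> eg; congr (_ && _); apply/agree1P/agree1P => E a ad; rewrite -E // eg.
Qed.

Lemma eq_base_change g g' h h' : {in idx d &, g =2 g'} -> {in idx d &, h =2 h'} ->
  base_change d g h = base_change d g' h'.
Proof.
move=> eg eh; rewrite /base_change (eq_inverse_pair eg eh) (eq_inverse_pair eh eg).
by rewrite (eq_pointed eg) (eq_pointed eh).
Qed.

(** A pointed pair is determined by its entries at positive indices, and these solve
    [inverse_polys]. *)
Lemma GL_complete g h : base_change d g h ->
  exists2 gh, gh \in GL d &
    {in idx d &, coef gh.1 =2 g} /\ {in idx d &, coef gh.2 =2 h}.
Proof.
move=> gh_bc; have [/agree2P gh /agree2P hg] := and3P gh_bc.
move=> /andP[/andP[/agree1P g0 /agree1P g0'] /andP[/agree1P h0 /agree1P h0']].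
(* Both matrices are packed row by row, [g] before [h]; the successors skip the reserved index 0. *)
pose f n := if n < d * d then g (n %/ d).+1 (n %% d).+1
  else h ((n - d * d) %/ d).+1 ((n - d * d) %% d).+1.
pose v := mkseq f (d * d + d * d).
have vg : {in idx d &, (fun i j => ev v (mvar d 0 i j)) =2 g}.
  move=> [|i] [|j]; rewrite !mem_idx /= => id jd; rewrite ?g0 ?g0' ?mem_idx //.
  have ij : i * d + j < d * d by nia.
  rewrite nth_mkseq ?ltn_addr // /f ij divnMDl ?(leq_trans _ id) // divn_small // addn0.
  by rewrite modnMDl modn_small.
have vh : {in idx d &, (fun i j => ev v (mvar d (d * d) i j)) =2 h}.
  move=> [|i] [|j]; rewrite !mem_idx /= => id jd; rewrite ?h0 ?h0' ?mem_idx //.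
  have ij : i * d + j < d * d by nia.
  rewrite nth_mkseq ?ltn_add2l // /f ltnNge leq_addr /= addKn.
  by rewrite divnMDl ?(leq_trans _ id) // divn_small // addn0 modnMDl modn_small.
have v_sol : v \in solve (d * d + d * d) (inverse_polys d).
  rewrite -[X in solve X](size_mkseq f).
  apply: mem_solve; rewrite all_allpairs; apply/allP=> i ip; apply/allP=> k kp.
  have [id kd] : i \in idx d /\ k \in idx d by move: ip kp; rewrite !mem_iota; lia.
  rewrite ev_add ev_sum -map_comp negb_add eq_sym -gh //; apply/eqP.
  by apply: eq_xsum => a ad; rewrite /= ev_mul -vg // -vh.
exists (tab2 d (fun i j => ev v (mvar d 0 i j)), tab2 d (fun i j => ev v (mvar d (d * d) i j))).
  rewrite mem_filter /= (eq_base_change (coef_tab2 _) (coef_tab2 _)).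
  by rewrite (eq_base_change vg vh) gh_bc map_f.
by split=> i j id jd; rewrite /= coef_tab2 // (vg, vh).
Qed.

(** For a multiplication the third clause says that the counit is multiplicative; for a
    comultiplication, that 1 is grouplike. *)
Definition unital t := {in idx d &, forall j k,
    [/\ t 0 j k = (j == k), t j 0 k = (j == k) & t j k 0 = (0 == j) && (0 == k)]}.

(* Satisfied by the multiplication tables of [H] in adapted bases, and by its
   comultiplication tables. *)
Record table_family (R : (nat -> nat -> nat -> bool) -> Prop) : Prop := TableFamily {
  fam_eq : forall t u, {in idx d & &, forall i j k, t i j k = u i j k} -> R t -> R u;
  fam_unit : forall t, R t -> unital t;
  fam_assoc : forall t, R t -> forall i j k l,
    i \in idx d -> j \in idx d -> k \in idx d -> l \in idx d ->
    xsum [seq t i j a && t a k l | a <- idx d] = xsum [seq t j k a && t i a l | a <- idx d];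
  fam_move : forall t g h, R t -> admissible d g h t -> R (xrebase d g h t);
  fam_conj : forall t u, R t -> R u -> exists g h, base_change d g h /\
    {in idx d & &, forall i j k, xrebase d g h t i j k = u i j k}
}.

Lemma xsum_delta (f : nat -> bool) : xsum [seq (0 == k) && f k | k <- idx d] = f 0.
Proof.
rewrite /= (_ : xsum _ = false) ?addbF //.
by rewrite xsumE big_map big1_seq // => k /andP[_]; rewrite mem_iota; case: k.
Qed.

Lemma map_code T T' (f : T -> T') (t : nat -> nat -> nat -> T) :
  map f (code d t) = code d (fun i j k => f (t i j k)).
Proof.
rewrite /code map_flatten map_allpairs; congr flatten.
by apply: eq_allpairs => i j; rewrite -map_comp.
Qed.

Lemma size_code T (t : nat -> nat -> nat -> T) :
  size (code d t) = size (code d (fun _ _ _ => tt)).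
Proof. by rewrite -(map_code (fun=> tt) t) size_map. Qed.

Lemma eq_code t u : {in idx d & &, forall i j k, t i j k = u i j k} ->
  code d t = code d u.
Proof.
move=> tu; congr flatten; apply/eq_in_allpairs => i j ip jp; apply/eq_in_map=> k kp.
by apply: tu; rewrite inE ?ip ?jp ?kp orbT.
Qed.

(** The bits read as a binary number, leading bit first: the measure that decreases when a table is
    replaced by a lexicographically smaller one. *)
Fixpoint lex_val (bs : seq bool) :=
  if bs is b :: bs' then b * 2 ^ size bs' + lex_val bs' else 0.

Lemma lex_val_lt bs : lex_val bs < 2 ^ size bs.
Proof.
elim: bs => //= b bs IH; rewrite expnS; move: (2 ^ _) (lex_val _) IH => N n.
by case: b; rewrite ?mul1n ?mul0n; lia.
Qed.

(** A leading bit outweighs the whole tail by [lex_val_lt]. *)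
Lemma lex_ltP v xs ys : size xs = size ys -> ev v (lex_lt xs ys) ->
  lex_val [seq ev v x | x <- xs] < lex_val [seq ev v y | y <- ys].
Proof.
elim: xs ys => [|x xs IH] [|y ys] // [sz].
rewrite -[lex_lt _ _]/(eadd (emul (eadd (Cst true) x) y)
  (emul (eadd (Cst true) (eadd x y)) (lex_lt xs ys))).
rewrite !(ev_add, ev_mul) [lex_val _]/= [lex_val (map _ (y :: _))]/= !size_map sz.
have := lex_val_lt [seq ev v x | x <- xs]; have := IH ys sz; rewrite size_map sz.
move: (2 ^ _) (lex_val _) (lex_val _) => N n n'.
by case: (ev v x) (ev v y) => [] []; case: (ev v _); rewrite /= ?mul1n ?mul0n; lia.
Qed.

Lemma ev_rebase v g h (t : nat -> nat -> nat -> expr) i j k :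
  ev v (rebase d eadd (Cst false) g h t i j k) =
  xrebase d g h (fun a b c => ev v (t a b c)) i j k.
Proof. by rewrite -[LHS]/(ev v (esum _)) ev_sum map_allpairs. Qed.

(** A pointed change keeps the augmentation, which is multiplicative by the third clause of
    [unital]. *)
Lemma base_change_admissible g h t : unital t -> base_change d g h -> admissible d g h t.
Proof.
move=> t1 /and3P[gh hg /andP[/andP[g0 _] /andP[_ /agree1P h0]]].
rewrite /admissible gh hg g0 /=; apply/agree2P => i j id jd; rewrite !h0 //.
have [_ _ <-] := t1 i j id jd.
by rewrite -(xsum_delta (t i j)); apply: eq_xsum => k kd; rewrite h0.
Qed.

Section Encode.
Variable t : nat -> nat -> nat -> bool.
Hypothesis t1 : unital t.

(** Inverse of the numbering in [tvar]: the three base-[d] digits of [n], each raised by one. *)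
Definition encode := mkseq (fun n => t (n %/ (d * d)).+1 ((n %/ d) %% d).+1 (n %% d).+1)
  (d * d * d).

Lemma ev_tvar : {in idx d & &, forall i j k, ev encode (tvar d i j k) = t i j k}.
Proof.
have d0 : 0 \in idx d by rewrite mem_idx.
move=> i j k id jd kd; case: i id => [|i] id; first by have [-> _ _] := t1 jd kd.
case: j jd => [|j] jd; first by have [_ -> _] := t1 id kd.
case: k kd => [|k] kd; first by have [_ _ ->] := t1 id jd.
move: id jd kd; rewrite !mem_idx /= => id jd kd.
have lt : (i * d + j) * d + k < d * d * d by nia.
rewrite nth_mkseq // modnMDl (modn_small kd).
rewrite divnMDl ?(leq_trans _ id) // (divn_small kd) addn0 modnMDl (modn_small jd).
rewrite mulnDl -addnA -mulnA divnMDl ?muln_gt0 ?(leq_trans _ id) //.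
by rewrite [_ %/ _]divn_small ?addn0 //; nia.
Qed.

Lemma encode_assoc : (forall i j k l,
    i \in idx d -> j \in idx d -> k \in idx d -> l \in idx d ->
    xsum [seq t i j a && t a k l | a <- idx d] = xsum [seq t j k a && t i a l | a <- idx d]) ->
  all (fun p => ~~ ev encode p) (assoc_polys d).
Proof.
move=> tA; rewrite /assoc_polys all_flatten all_allpairs.
apply/allP=> i ip; apply/allP=> j jp; rewrite all_allpairs.
apply/allP=> k kp; apply/allP=> l lp.
have [id jd kd ld] : [/\ i \in idx d, j \in idx d, k \in idx d & l \in idx d].
  by rewrite !inE ip jp kp lp !orbT.
have xsum_pos (f : nat -> bool) : f 0 = false ->
    xsum [seq f a | a <- iota 1 d] = xsum [seq f a | a <- idx d] by move=> /= ->.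
have t0 p q : p \in iota 1 d -> q \in iota 1 d -> p \in idx d -> q \in idx d -> t p q 0 = false.
  by move=> pp qp pd qd; have [_ _ ->] := t1 pd qd; case: p pp {pd}; rewrite ?mem_iota.
rewrite ev_add !ev_sum -!map_comp negb_add; apply/eqP.
transitivity (xsum [seq t i j a && t a k l | a <- iota 1 d]).
  apply: eq_xsum => a ap; have ad : a \in idx d by rewrite inE ap orbT.
  by rewrite /= ev_mul !ev_tvar.
rewrite xsum_pos ?t0 // tA // -xsum_pos ?t0 //; apply: eq_xsum => a ap.
have ad : a \in idx d by rewrite inE ap orbT.
by rewrite /= ev_mul !ev_tvar.
Qed.

End Encode.

Section NormalForms.
Variable R : (nat -> nat -> nat -> bool) -> Prop.
Hypothesis famR : table_family R.

(** Descent on [lex_val]: if a polynomial of [lex_polys] does not vanish, the corresponding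
    involution gives a smaller table, again in the family by [fam_move]. *)
Lemma minimal_tables_complete t : R t ->
  exists2 m, m \in minimal_tables d (GL d) & R (entry m).
Proof.
have [N] := ubnP (lex_val (code d t)); elim: N t => // N IH t; rewrite ltnS => tN Rt.
have t1 : unital t := fam_unit famR Rt; have tv := ev_tvar t1.
have vA := encode_assoc t1 (fam_assoc famR Rt).
have [vL|] := boolP (all (fun p => ~~ ev (encode t) p) (lex_polys d (GL d))).
  exists (tab3 d (fun i j k => ev (encode t) (tvar d i j k))).
    apply: map_f; have <- : size (encode t) = d * d * d by rewrite size_mkseq.
    by apply: mem_solve; rewrite all_cat vA.
  by apply: fam_eq Rt => // i j k id jd kd; rewrite entry_tab3 ?tv.
rewrite all_map -has_predC => /hasP[[g g']]; rewrite mem_filter /= => /andP[/eqP<- gG].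
rewrite negbK => /lex_ltP; rewrite !map_code size_code [RHS]size_code => /(_ erefl).
rewrite (eq_code tv) => lt_gt.
(* Both components of the listed pair are [g], so [g] is an involution. *)
have gP : base_change d (coef g) (coef g) by move: gG; rewrite mem_filter => /andP[].
apply: (IH (xrebase d (coef g) (coef g) t)); last first.
  exact/(fam_move famR Rt)/base_change_admissible.
apply: leq_trans tN; move: lt_gt; congr (lex_val _ < _).
apply: eq_code => i j k id jd kd; rewrite ev_rebase; exact: eq_xrebase.
Qed.

(** A translate of [m] stays in the family by [fam_move], and any two members are conjugate by
    [fam_conj]. *)
Lemma minimal_tables_homogeneous m : R (entry m) -> homogeneous d (GL d) m.
Proof.
move=> Rm; apply/allP=> a; rewrite mem_filter => /andP[adm _].
have Rm' := fam_move famR Rm adm.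
have [g [h [gh_bc ghE]]] := fam_conj famR Rm Rm'.
have [gh ghG [eg eh]] := GL_complete gh_bc.
cbv zeta; rewrite someE; apply/hasP; exists gh => //; apply/agree3P=> i j k id jd kd.
rewrite entry_tab3 // -ghE //; exact: eq_xrebase.
Qed.

Lemma normal_forms_complete t : R t ->
  exists2 m, m \in normal_forms d (GL d) & R (entry m).
Proof.
move=> /minimal_tables_complete[m mM Rm]; exists m => //.
by rewrite mem_filter minimal_tables_homogeneous.
Qed.

Lemma orbit_complete n t : R (entry n) -> R t ->
  exists2 c, c \in orbit d (GL d) n & {in idx d & &, forall i j k, entry c i j k = t i j k}.
Proof.
move=> Rn /(fam_conj famR Rn)[g [h [/GL_complete[gh ghG [eg eh]] ghE]]].
pose u := tab3 d (xrebase d (coef gh.1) (coef gh.2) (entry n)).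
have uE : {in idx d & &, forall i j k, entry u i j k = t i j k}.
  by move=> i j k id jd kd; rewrite entry_tab3 // -ghE //; exact: eq_xrebase.
have: u \in [seq tab3 d (xrebase d (coef gh.1) (coef gh.2) (entry n)) | gh <- GL d].
  exact: map_f.
(* [dedup] discards a table only when an agreeing one is kept. *)
rewrite /orbit; elim: (map _ _) => //= v s IH; rewrite someE inE => /orP[/eqP<-|/IH[c cs cE]].
  case: ifP => [/hasP[c cs /agree3P uc] | _]; last by exists u; rewrite ?mem_head.
  by exists c => // i j k id jd kd; rewrite -uc // uE.
by exists c => //; case: ifP => // _; rewrite inE cs orbT.
Qed.

End NormalForms.

(** The witness [c0] is the head of the list of Hopf comultiplications, hence depends on [m] and [n]
    alone and can serve two Hopf algebras at once. *)
Lemma rigid_conjugate m n : rigid d ->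
  m \in normal_forms d (GL d) -> n \in normal_forms d (GL d) ->
  exists c0, forall c, c \in orbit d (GL d) n -> compatible d m (with_cosupports d c) ->
    has_antipode d m (with_cosupports d c) ->
  exists g h, [/\ base_change d g h,
    {in idx d & &, forall i j k, xrebase d g h (entry m) i j k = entry m i j k} &
    {in idx d & &, forall i j k,
      xrebase d (fun i j => h j i) (fun i j => g j i) (entry c) i j k = entry c0 i j k}].
Proof.
move=> /allP/(_ m) + mM nM => /(_ mM)/allP/(_ _ (map_f _ nM)) /=.
set C := hopf_comuls _ _ _ => /allP allC; exists (head [::] C) => c cO c_comp c_anti.
have cC : c \in C.
  rewrite -[c]/(with_cosupports d c).1; apply: map_f.
  by rewrite !mem_filter c_comp c_anti map_f.
have := allC c cC; rewrite /conjugate_to someE => /hasP[gh].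
rewrite mem_filter => /andP[/agree3P mE ghG] /agree3P cE.
exists (coef gh.1), (coef gh.2); split=> //.
by move: ghG; rewrite mem_filter => /andP[].
Qed.

End TableTheory.

Local Open Scope ring_scope.

(** * Frames and tensors *)

Lemma sum_delta (V : nmodType) d k (f : nat -> V) : k \in idx d ->
  \sum_(i <- idx d) f i *+ (i == k) = f k.
Proof.
move=> kd; rewrite (bigD1_seq k) ?iota_uniq //= eqxx big1 ?addr0 // => i /negPf->.
by rewrite mulr0n.
Qed.

Lemma sum_deltal (F : pzRingType) (V : lmodType F) d k (f : nat -> V) : k \in idx d ->
  \sum_(i <- idx d) (i == k)%:R *: f i = f k.
Proof.
by move=> kd; rewrite -[RHS](sum_delta f kd); apply: eq_bigr => i _; rewrite scaler_nat.
Qed.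

Section Frames.
Variables (F : fieldType) (d : nat).

(** A basis with its dual basis, indexed by natural numbers to match the tables; values beyond [d]
    are unconstrained. *)
Record frame (V : vectType F) (X : nat -> V) (xi : nat -> 'Hom(V, F^o)) : Prop :=
  Frame {
    frame_dual : {in idx d &, forall i j, xi i (X j) = (i == j)%:R};
    frame_span : forall v, v = \sum_(i <- idx d) xi i v *: X i
  }.

Lemma frame_change (V : vectType F) X (xi : nat -> 'Hom(V, F^o)) (g h : nat -> nat -> F) :
  frame X xi ->
  {in idx d &, forall i k, \sum_(a <- idx d) g i a * h a k = (i == k)%:R} ->
  {in idx d &, forall i k, \sum_(a <- idx d) h i a * g a k = (i == k)%:R} ->
  frame (fun i => \sum_(a <- idx d) g i a *: X a)
        (fun k => \sum_(c <- idx d) h c k *: xi c).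
Proof.
move=> fX gh hg; split=> [i j id jd | v].
  rewrite sum_lfunE -[RHS](_ : (j == i)%:R = _); last by rewrite eq_sym.
  rewrite -gh //; apply: eq_big_seq => c cd.
  rewrite scale_lfunE linear_sum [_ *: _]mulrC; congr (_ * _).
  rewrite -(sum_delta (g j) cd); apply: eq_big_seq => a ad.
  by rewrite linearZ /= (frame_dual fX) // [LHS]mulr_natr eq_sym.
rewrite {1}[v](frame_span fX).
transitivity (\sum_(c <- idx d) \sum_(a <- idx d)
   (\sum_(k <- idx d) h c k * g k a) *: (xi c v *: X a)).
  apply: eq_big_seq => c cd.
  rewrite -(sum_deltal (fun a => xi c v *: X a) cd).
  by apply: eq_big_seq => a ad; rewrite hg // eq_sym.
transitivity (\sum_(c <- idx d) \sum_(k <- idx d) \sum_(a <- idx d)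
   (h c k * g k a) *: (xi c v *: X a)).
  apply: eq_bigr => c _; rewrite [RHS]exchange_big; apply: eq_bigr => a _.
  by rewrite scaler_suml.
rewrite exchange_big; apply: eq_bigr => k _; rewrite sum_lfunE scaler_suml.
apply: eq_bigr => c _; rewrite scale_lfunE scaler_sumr; apply: eq_bigr => a _.
by rewrite -[h c k *: xi c v]/(h c k * xi c v) !scalerA mulrAC.
Qed.

Lemma frame_transfer (V W : vectType F) X xi (f : V -> W) (f' : 'Hom(W, V)) :
  linear f -> cancel f f' -> cancel f' f -> frame X xi ->
  frame (fun i => f (X i)) (fun i => (xi i \o f')%VF).
Proof.
move=> f_lin fK f'K fX; split=> [i j id jd | v].
  by rewrite comp_lfunE fK (frame_dual fX).
pose fl := GRing.isLinear.Build _ _ _ _ f f_lin.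
pose fL : {linear V -> W} := HB.pack f fl.
rewrite -{1}[v]f'K {1}[f' v](frame_span fX) -[LHS]/(fL _) linear_sum.
by apply: eq_bigr => i _; rewrite comp_lfunE linearZ.
Qed.

Lemma frame_eqP (V : vectType F) X xi (u v : V) : frame X xi ->
  {in idx d, forall i, xi i u = xi i v} -> u = v.
Proof.
move=> fX uv; rewrite [u](frame_span fX) [v](frame_span fX).
by apply: eq_big_seq => i id; rewrite uv.
Qed.

End Frames.

Section TensorFrames.
Variables (F : fieldType) (U V : vectType F).

(** The functional [f (x) g]; it extracts tensor coordinates in any pair of frames. *)
Definition tpair (f : 'Hom(U, F^o)) (g : 'Hom(V, F^o)) : tensor U V -> F^o :=
  tens_lift (fun u v => f u * g v : F^o).

HB.instance Definition _ f g := GRing.isLinear.Build F (tensor U V) F^o *:%R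
  (tpair f g) (tens_lift_is_linear _).

Definition bilin (W : vectType F) (f : U -> V -> W) :=
  (forall x, linear (f x)) /\ (forall y, linear (f^~ y)).

Lemma bilin_tpair (f : 'Hom(U, F^o)) (g : 'Hom(V, F^o)) :
  bilin (fun u v => f u * g v : F^o).
Proof.
split=> [x a y z | y a x z]; rewrite linearP /=.
  by rewrite mulrDr -!scalerAr.
by rewrite mulrDl -!scalerAl.
Qed.

Lemma bilin_tens : bilin (@tens F U V).
Proof. by split=> [x a y z|y a x z]; rewrite (tens_linearr, tens_linearl). Qed.

Lemma tpairE f g u v : tpair f g (tens u v) = f u * g v.
Proof. by have [? ?] := bilin_tpair f g; rewrite /tpair tens_liftE. Qed.

Lemma tens_lift_tens (t : tensor U V) : tens_lift (@tens F U V) t = t.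
Proof. by rewrite [RHS]tensor_sum. Qed.

Variables (d e : nat) (X : nat -> U) (xi : nat -> 'Hom(U, F^o)).
Variables (Y : nat -> V) (eta : nat -> 'Hom(V, F^o)).
Hypotheses (fX : frame d X xi) (fY : frame e Y eta).

Lemma bilin_frame (W : vectType F) (f : U -> V -> W) u v : bilin f ->
  f u v = \sum_(i <- idx d) \sum_(j <- idx e) (xi i u * eta j v) *: f (X i) (Y j).
Proof.
case=> fr fl.
pose fRl x := GRing.isLinear.Build _ _ _ _ (f x) (fr x).
pose fLl y := GRing.isLinear.Build _ _ _ _ (f^~ y) (fl y).
pose fR x : {linear V -> W} := HB.pack (f x) (fRl x).
pose fL y : {linear U -> W} := HB.pack (f^~ y) (fLl y).
rewrite -[LHS]/(fL v u) {1}[u](frame_span fX) linear_sum; apply: eq_bigr => i _.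
rewrite linearZ /= -[f _ v]/(fR (X i) v) {1}[v](frame_span fY) linear_sum scaler_sumr.
by apply: eq_bigr => j _; rewrite linearZ scalerA.
Qed.

(** Frees [tens_lift] from the basis [vbas] used to define it: the vectors [vbas] are expanded in
    the frames and the sums exchanged. *)
Lemma tens_lift_frame (W : vectType F) (f : U -> V -> W) t : bilin f ->
  tens_lift f t =
    \sum_(i <- idx d) \sum_(j <- idx e) tpair (xi i) (eta j) t *: f (X i) (Y j).
Proof.
move=> bf; rewrite /tens_lift.
transitivity (\sum_p \sum_q \sum_(i <- idx d) \sum_(j <- idx e)
   ((t : 'M[F]_(_, _)) p q * (xi i (vbas p) * eta j (vbas q))) *: f (X i) (Y j)).
  apply: eq_bigr => p _; apply: eq_bigr => q _; rewrite (bilin_frame _ _ bf) scaler_sumr.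
  by apply: eq_bigr => i _; rewrite scaler_sumr; apply: eq_bigr => j _; rewrite scalerA.
under eq_bigr do rewrite exchange_big.
rewrite exchange_big; apply: eq_bigr => i _ /=.
under eq_bigr do rewrite exchange_big.
rewrite exchange_big; apply: eq_bigr => j _ /=.
rewrite /tpair /tens_lift scaler_suml; apply: eq_bigr => p _.
by rewrite scaler_suml.
Qed.

Lemma tensor_frame (t : tensor U V) :
  t = \sum_(i <- idx d) \sum_(j <- idx e) tpair (xi i) (eta j) t *: tens (X i) (Y j).
Proof. by rewrite -{1}[t]tens_lift_tens; apply/tens_lift_frame/bilin_tens. Qed.

End TensorFrames.

Section TensorPairing.
Variable F : fieldType.

Lemma tpair_suml (U V : vectType F) (r : seq nat) (a : nat -> F)
    (f : nat -> 'Hom(U, F^o)) (g : 'Hom(V, F^o)) t :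
  tpair (\sum_(i <- r) a i *: f i) g t = \sum_(i <- r) a i * tpair (f i) g t.
Proof.
elim/big_rec2: _ => [|i x h _ <-].
  rewrite /tpair /tens_lift big1 // => p _; rewrite big1 // => q _.
  by rewrite lfunE /= mul0r scaler0.
apply: tens_lift_linear_fun => u v.
by rewrite add_lfunE scale_lfunE mulrDl -!scalerAl.
Qed.

Lemma tpair_sumr (U V : vectType F) (r : seq nat) (a : nat -> F)
    (f : 'Hom(U, F^o)) (g : nat -> 'Hom(V, F^o)) t :
  tpair f (\sum_(i <- r) a i *: g i) t = \sum_(i <- r) a i * tpair f (g i) t.
Proof.
elim/big_rec2: _ => [|i x h _ <-].
  rewrite /tpair /tens_lift big1 // => p _; rewrite big1 // => q _.
  by rewrite lfunE /= mulr0 scaler0.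
apply: tens_lift_linear_fun => u v.
by rewrite add_lfunE scale_lfunE mulrDr -!scalerAr.
Qed.

Lemma frame_lfun d (V : vectType F) X (xi : nat -> 'Hom(V, F^o)) (f : 'Hom(V, F^o)) :
  frame d X xi -> f = \sum_(a <- idx d) f (X a) *: xi a.
Proof.
move=> fX; apply/lfunP=> v; rewrite {1}[v](frame_span fX) linear_sum sum_lfunE.
by apply: eq_bigr => a _; rewrite linearZ scale_lfunE [LHS]mulrC.
Qed.

Lemma tpair_assoc (U V W : vectType F) (f : 'Hom(U, F^o)) (g : 'Hom(V, F^o))
    (h : 'Hom(W, F^o)) t :
  tpair f (linfun (tpair g h)) (tens_assoc t) = tpair (linfun (tpair f g)) h t.
Proof.
have E : tpair f (linfun (tpair g h)) \o @tens_assoc F U V W =1 tpair (linfun (tpair f g)) h.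
  apply: tens_ext => s w.
  (* For fixed [w] both sides are linear in [s], so [tens_ext] applies a second time. *)
  pose tl := GRing.isLinear.Build _ _ _ _ ((@tens F (tensor U V) W)^~ w) (tens_linearl w).
  pose tL : {linear tensor U V -> tensor (tensor U V) W} :=
    HB.pack ((@tens F (tensor U V) W)^~ w) tl.
  pose G : {linear _ -> F^o} := tpair f (linfun (tpair g h)) \o (@tens_assoc F U V W \o tL).
  rewrite /= [in RHS]tpairE lfunE mulrC -[RHS]/(( *%R (h w) \o tpair f g) s).
  pose G' : {linear _ -> F^o} := h w \*: tpair f g.
  apply: (@tens_ext _ _ _ _ G G') => u v.
  rewrite /G /G' /= tens_assocE !tpairE lfunE /= tpairE.
  by rewrite -[RHS]/(h w * (f u * g v)) mulrA mulrC.
exact: E.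
Qed.

Lemma tpair_map (U U' V V' : vectType F) (f : 'Hom(U', F^o)) (g : 'Hom(V', F^o))
   (A : {linear U -> U'}) (B : {linear V -> V'}) t :
  tpair f g (tens_map A B t) = tpair (linfun (f \o A)) (linfun (g \o B)) t.
Proof.
have E : tpair f g \o tens_map A B =1 tpair (linfun (f \o A)) (linfun (g \o B)).
  by apply: tens_ext => u v; rewrite /= tens_mapE !tpairE !lfunE.
exact: E.
Qed.

End TensorPairing.

(** * Structure constants of a Hopf algebra *)

Section FrameTables.
Variables (F : fieldType) (d : nat) (H : hopfAlgType F).
Implicit Types (X : nat -> H) (xi : nat -> 'Hom(H, F^o)).

Definition mul_tab X xi i j k : F := xi k (X i * X j).
Definition comul_tab X xi i j k : F := tpair (xi i) (xi j) (comul (X k)).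

Definition rebase_tab (g h : nat -> nat -> F) (t : nat -> nat -> nat -> F) i j k : F :=
  \sum_(a <- idx d) \sum_(b <- idx d) \sum_(c <- idx d) g i a * (g j b * (h c k * t a b c)).

Lemma comul_coassoc (f g h : 'Hom(H, F^o)) x :
  tpair (linfun (tpair f g \o comul)) h (comul x)
    = tpair f (linfun (tpair g h \o comul)) (comul x).
Proof.
have := congr1 (tpair f (linfun (tpair g h))) (comulA x).
rewrite tpair_assoc !tpair_map.
have compE (f' g' : 'Hom(H, F^o)) :
    linfun (linfun (tpair f' g') \o comul) = linfun (tpair f' g' \o comul).
  by apply/lfunP=> y; rewrite !lfunE /= lfunE.
have idE (f' : 'Hom(H, F^o)) : linfun (f' \o idfun) = f'.
  by apply/lfunP=> y; rewrite lfunE.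
by rewrite !compE !idE.
Qed.

Section Fixed.
Variables (X : nat -> H) (xi : nat -> 'Hom(H, F^o)).
Hypothesis fX : frame d X xi.
Local Notation m := (mul_tab X xi).
Local Notation n := (comul_tab X xi).

Lemma mul_frame i j : X i * X j = \sum_(k <- idx d) m i j k *: X k.
Proof. exact: frame_span. Qed.

Lemma comul_frame k :
  comul (X k) = \sum_(i <- idx d) \sum_(j <- idx d) n i j k *: tens (X i) (X j).
Proof. exact: tensor_frame. Qed.

Lemma mul_tabA i j k l :
  \sum_(a <- idx d) m i j a * m a k l = \sum_(a <- idx d) m j k a * m i a l.
Proof.
transitivity (xi l (X i * X j * X k)).
  rewrite mul_frame mulr_suml linear_sum; apply: eq_bigr => a _.
  by rewrite -scalerAl linearZ.
rewrite -mulrA [X j * _]mul_frame mulr_sumr linear_sum; apply: eq_bigr => a _.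
by rewrite -scalerAr linearZ.
Qed.

Lemma comul_tabA i j k l :
  \sum_(a <- idx d) n i j a * n a k l = \sum_(a <- idx d) n j k a * n i a l.
Proof.
have := comul_coassoc (xi i) (xi j) (xi k) (X l).
rewrite (frame_lfun (linfun (tpair (xi i) (xi j) \o comul)) fX) tpair_suml.
rewrite (frame_lfun (linfun (tpair (xi j) (xi k) \o comul)) fX) tpair_sumr.
by under eq_bigr do rewrite lfunE; under [RHS]eq_bigr do rewrite lfunE.
Qed.

Lemma mul_tab_rebase g h (Z : nat -> H) (zeta : nat -> 'Hom(H, F^o)) i j k :
  Z i = \sum_(a <- idx d) g i a *: X a -> Z j = \sum_(a <- idx d) g j a *: X a ->
  zeta k = \sum_(c <- idx d) h c k *: xi c ->
  mul_tab Z zeta i j k = rebase_tab g h m i j k.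
Proof.
move=> Zi Zj zk; rewrite /mul_tab Zi Zj zk mulr_suml linear_sum; apply: eq_bigr => a _.
rewrite mulr_sumr linear_sum; apply: eq_bigr => b _ /=.
rewrite sum_lfunE; apply: eq_bigr => c _.
rewrite scale_lfunE -scalerAl -scalerAr !linearZ /=.
by [].
Qed.

Lemma comul_tab_rebase g h (Z : nat -> H) (zeta : nat -> 'Hom(H, F^o)) i j k :
  Z k = \sum_(c <- idx d) g k c *: X c ->
  zeta i = \sum_(a <- idx d) h a i *: xi a -> zeta j = \sum_(b <- idx d) h b j *: xi b ->
  comul_tab Z zeta i j k = rebase_tab (fun p q => h q p) (fun p q => g q p) n i j k.
Proof.
move=> Zk zi zj; rewrite /comul_tab zi zj tpair_suml; apply: eq_bigr => a _.
rewrite tpair_sumr mulr_sumr; apply: eq_bigr => b _.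
rewrite Zk linear_sum (linear_sum (tpair _ _)) !mulr_sumr; apply: eq_bigr => c _.
by rewrite linearZ (linearZZ (tpair _ _)).
Qed.

Lemma bilin_antipode : bilin (fun x y : H => antipode x * y).
Proof.
split=> [x a y z | y a x z]; first by rewrite mulrDr -scalerAr.
by rewrite linearP mulrDl -scalerAl.
Qed.

(** Coordinate [p] of the left antipode axiom at [X k]: the linear system behind
    [antipode_polys]. *)
Lemma antipode_tab k p : k \in idx d -> p \in idx d ->
  \sum_(i <- idx d) \sum_(j <- idx d) \sum_(a <- idx d)
     n i j k * (m a j p * xi a (antipode (X i))) = counit (X k) * xi p 1.
Proof.
move=> kd pd; transitivity (xi p (counit (X k))%:A); last by rewrite (linearZZ (xi p)).
rewrite -antipodel.
rewrite (tens_lift_frame fX fX); last exact: bilin_antipode.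
rewrite (linear_sum (xi p)); apply: eq_bigr => i _.
rewrite (linear_sum (xi p)); apply: eq_bigr => j _.
rewrite (linearZZ (xi p)) [in RHS](frame_span fX (antipode (X i))) mulr_suml.
rewrite (linear_sum (xi p)) scaler_sumr; apply: eq_bigr => a _.
rewrite -scalerAl (linearZZ (xi p)).
by rewrite -[RHS]/(n i j k * (xi a _ * m a j p)) [xi a _ * _]mulrC.
Qed.

Lemma bilin_mul_tens (u v : H) : bilin (fun c e : H => tens (u * c) (v * e)).
Proof.
split=> [x k y z|x k y z].
  by rewrite mulrDr -scalerAr tens_linearr.
by rewrite mulrDr -scalerAr tens_linearl.
Qed.

Lemma bilin_tens_mul (t : tensor H H) :
  bilin (fun a b : H => tens_lift (fun c e => tens (a * c) (b * e)) t).
Proof.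
split=> x k y z; apply: tens_lift_linear_fun => u v.
  by rewrite mulrDl -scalerAl tens_linearr.
by rewrite mulrDl -scalerAl tens_linearl.
Qed.

Lemma tpair_mul f g (s t : tensor H H) : tpair f g (tens_mul s t) =
  \sum_(a <- idx d) \sum_(b <- idx d) \sum_(c <- idx d) \sum_(e <- idx d)
    tpair (xi a) (xi b) s * (tpair (xi c) (xi e) t * (f (X a * X c) * g (X b * X e))).
Proof.
rewrite /tens_mul (tens_lift_frame fX fX); last exact: bilin_tens_mul.
rewrite (linear_sum (tpair _ _)); apply: eq_bigr => a _.
rewrite (linear_sum (tpair _ _)); apply: eq_bigr => b _.
rewrite (linearZZ (tpair _ _)) /= (tens_lift_frame fX fX); last exact: bilin_mul_tens.
rewrite (linear_sum (tpair _ _)) scaler_sumr; apply: eq_bigr => c _.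
rewrite (linear_sum (tpair _ _)) scaler_sumr; apply: eq_bigr => e _.
by rewrite (linearZZ (tpair _ _)) /= tpairE.
Qed.

(** Coordinates of [comulM], in the form tested by [compatible_at]. *)
Lemma mul_comul_tab i j p q :
  \sum_(k <- idx d) m i j k * n p q k =
  \sum_(a <- idx d) \sum_(b <- idx d) \sum_(c <- idx d) \sum_(e <- idx d)
    n a b i * (n c e j * (m a c p * m b e q)).
Proof.
rewrite -tpair_mul -comulM {1}mul_frame linear_sum (linear_sum (tpair _ _)).
by apply: eq_bigr => k _; rewrite linearZ (linearZZ (tpair _ _)).
Qed.

End Fixed.
End FrameTables.

Lemma eq_tens_lift (F : fieldType) (U V W : vectType F) (f g : U -> V -> W) :
  f =2 g -> tens_lift f =1 tens_lift g.
Proof. by move=> fg t; apply: eq_bigr => p _; apply: eq_bigr => q _; rewrite fg. Qed.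

Lemma linear_tens_lift (F : fieldType) (U V W W' : vectType F) (f : U -> V -> W)
    (g : {linear W -> W'}) t :
  g (tens_lift f t) = tens_lift (fun u v => g (f u v)) t.
Proof.
rewrite /tens_lift linear_sum; apply: eq_bigr => p _; rewrite linear_sum.
by apply: eq_bigr => q _; rewrite linearZ.
Qed.

(** * Translations *)

Section Translation.
Variables (F : fieldType) (d : nat) (H : hopfAlgType F).
Implicit Types (X : nat -> H) (xi : nat -> 'Hom(H, F^o)) (chi g : 'Hom(H, F^o)).

Definition epsilon : 'Hom(H, F^o) := linfun (counit : H -> F^o).

Lemma epsilonE v : epsilon v = counit v.
Proof. by rewrite lfunE. Qed.

Lemma tpair_counitl g v : tpair epsilon g (comul v) = g v.
Proof.
rewrite -[in RHS](counitl v) (linear_tens_lift _ g); apply: eq_tens_lift => x y.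
by rewrite linearZ lfunE.
Qed.

Lemma tpair_counitr g v : tpair g epsilon (comul v) = g v.
Proof.
rewrite -[in RHS](counitr v) (linear_tens_lift _ g); apply: eq_tens_lift => x y.
by rewrite linearZ lfunE; rewrite -[RHS]/(counit y * g x) mulrC.
Qed.

Definition character chi := chi 1 = 1 /\ forall x y, chi (x * y) = chi x * chi y.

Definition translate chi : H -> H := tens_lift (fun x y => chi x *: y) \o comul.

HB.instance Definition _ chi := GRing.Linear.copy (translate chi)
  (tens_lift (fun x y => chi x *: y) \o comul).

Lemma translateP chi g v : g (translate chi v) = tpair chi g (comul v).
Proof. by rewrite (linear_tens_lift _ g); apply: eq_tens_lift => x y; rewrite linearZ. Qed.

Definition convolve chi g : 'Hom(H, F^o) := linfun (tpair chi g \o comul).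

Variables (X0 : nat -> H) (xi0 : nat -> 'Hom(H, F^o)).
Hypothesis fX0 : frame d X0 xi0.

Lemma eq_functional (u v : H) : (forall g, g u = g v) -> u = v.
Proof. by move=> uv; apply: (frame_eqP fX0) => i _. Qed.

(** Coassociativity turns composition of translations into convolution of functionals. *)
Lemma translate_comp chi psi v :
  translate psi (translate chi v) = translate (convolve chi psi) v.
Proof.
apply: eq_functional => g.
rewrite translateP -[LHS](_ : convolve psi g (translate chi v) = _); last by rewrite lfunE.
by rewrite !translateP comul_coassoc.
Qed.

Lemma translate_counit v : translate epsilon v = v.
Proof. by apply: eq_functional => g; rewrite translateP tpair_counitl. Qed.

Definition antipode_fun chi : 'Hom(H, F^o) := linfun (chi \o (antipode : H -> H)).

(** Applying a multiplicative [chi] to the antipode axiom inverts it under convolution; translations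
    by characters are therefore bijective. *)
Lemma convolve_antipoder chi : character chi -> convolve chi (antipode_fun chi) = epsilon.
Proof.
case=> chi1 chiM; apply/lfunP=> x; rewrite !lfunE /=.
transitivity (chi (counit x)%:A); last by rewrite linearZ /= chi1; apply: mulr1.
rewrite -antipoder (linear_tens_lift _ chi); apply: eq_tens_lift => u v.
by rewrite lfunE /= chiM.
Qed.

Lemma convolve_antipodel chi : character chi -> convolve (antipode_fun chi) chi = epsilon.
Proof.
case=> chi1 chiM; apply/lfunP=> x; rewrite !lfunE /=.
transitivity (chi (counit x)%:A); last by rewrite linearZ /= chi1; apply: mulr1.
rewrite -antipodel (linear_tens_lift _ chi); apply: eq_tens_lift => u v.
by rewrite lfunE /= chiM.
Qed.

Lemma translate1 chi : character chi -> translate chi 1 = 1.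
Proof.
case=> chi1 _; apply: eq_functional => g.
by rewrite translateP comul1 tpairE chi1 mul1r.
Qed.

Lemma translateM chi x y : character chi ->
  translate chi (x * y) = translate chi x * translate chi y.
Proof.
case=> _ chiM; apply: eq_functional => g; rewrite translateP comulM (tpair_mul fX0).
have tE v : translate chi v = \sum_(a <- idx d) \sum_(b <- idx d)
    tpair (xi0 a) (xi0 b) (comul v) *: ((chi (X0 a) : F) *: X0 b).
  rewrite -(tens_lift_frame fX0 fX0 (f := fun x y => chi x *: y)) //.
  split=> [u k z t|u k z t]; first by rewrite scalerDr !scalerA mulrC.
  by rewrite linearP scalerDl scalerA.
rewrite !tE mulr_suml (linear_sum g); apply: eq_bigr => a _.
rewrite mulr_suml (linear_sum g); apply: eq_bigr => b _.
rewrite mulr_sumr (linear_sum g); apply: eq_bigr => c _.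
rewrite mulr_sumr (linear_sum g); apply: eq_bigr => e _.
rewrite chiM -!scalerAl -!scalerAr !(linearZZ g).
rewrite -[LHS]/(_ * (_ * (_ * _))) -[RHS]/(_ * (_ * (_ * (_ * _)))).
rewrite [LHS]mulrCA [RHS]mulrCA; congr (_ * _).
by rewrite [RHS]mulrCA; congr (_ * _); apply: mulrCA.
Qed.

Definition adapted X xi := [/\ frame d X xi, X 0 = 1 & xi 0 = epsilon].

(** Translation by [chi = xi 0] is an algebra automorphism, so the table is kept, and it carries
    [chi] to the convolution of [antipode_fun chi] with [chi], which is the counit. *)
Lemma adapted_translate X xi : frame d X xi -> X 0 = 1 -> character (xi 0) ->
  exists Z zeta, adapted Z zeta /\ (forall i j k, mul_tab Z zeta i j k = mul_tab X xi i j k).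
Proof.
move=> fX X1 chiP; set chi := xi 0 in chiP.
have tK : cancel (translate chi) (linfun (translate (antipode_fun chi))).
  by move=> v; rewrite lfunE /= translate_comp convolve_antipoder // translate_counit.
have Kt : cancel (linfun (translate (antipode_fun chi))) (translate chi).
  by move=> v; rewrite lfunE /= translate_comp convolve_antipodel // translate_counit.
exists (fun i => translate chi (X i)).
exists (fun i => (xi i \o linfun (translate (antipode_fun chi)))%VF).
split; last first.
  by move=> i j k; rewrite /mul_tab comp_lfunE -translateM // tK.
split.
- by apply: frame_transfer fX => //; apply: linearP.
- by rewrite X1 translate1.
- apply/lfunP=> v; rewrite comp_lfunE lfunE -/chi.
  by rewrite /= translateP -(convolve_antipodel chiP) [RHS]lfunE.
Qed.

Lemma tpair_tens_mul (f g : 'Hom(H, F^o)) x y (t : tensor H H) :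
  tpair f g (tens_mul (tens x y) t) = tpair (f \o amull x)%VF (g \o amull y)%VF t.
Proof.
have [? ?] := bilin_tens_mul t.
rewrite /tens_mul tens_liftE //.
rewrite (linear_tens_lift _ (tpair f g)) [RHS]/tpair; apply: eq_tens_lift => u v.
by rewrite !comp_lfunE !lfunE /= tpairE.
Qed.

(** Left multiplication by the inverse [antipode gamma] of [gamma = X 0] sends [gamma] to 1. The
    dual frame is composed with multiplication by [gamma], which absorbs the factor in Delta(gamma
    y) = (gamma (x) gamma) Delta(y). *)
Lemma adapted_grouplike X xi : frame d X xi -> xi 0 = epsilon ->
  comul (X 0) = tens (X 0) (X 0) ->
  exists Z zeta, adapted Z zeta /\
    (forall i j k, comul_tab Z zeta i j k = comul_tab X xi i j k).
Proof.
move=> fX xi0E; set gamma := X 0 => gammaP.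
have eps_gamma : counit gamma = 1.
  by rewrite -epsilonE -xi0E (frame_dual fX) // mem_iota.
have SgK : antipode gamma * gamma = 1.
  have [? ?] := bilin_antipode H.
  by rewrite -[RHS]scale1r -eps_gamma -antipodel gammaP tens_liftE.
have gSK : gamma * antipode gamma = 1.
  rewrite -[RHS]scale1r -eps_gamma -antipoder gammaP tens_liftE // => [x a y z|y a x z].
    by rewrite linearP mulrDr -scalerAr.
  by rewrite mulrDl -scalerAl.
have mulK : cancel ( *%R (antipode gamma)) (amull gamma).
  by move=> v; rewrite lfunE /= mulrA gSK mul1r.
have Kmul : cancel (amull gamma) ( *%R (antipode gamma)).
  by move=> v; rewrite lfunE /= mulrA SgK mul1r.
exists (fun i => antipode gamma * X i), (fun i => (xi i \o amull gamma)%VF); split.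
  split=> //.
    by apply: frame_transfer fX => // a x y; rewrite mulrDr -scalerAr.
  apply/lfunP=> v; rewrite comp_lfunE lfunE /= xi0E !epsilonE.
  by rewrite counitM eps_gamma mul1r.
move=> i j k; rewrite /comul_tab.
rewrite -[in RHS](mulK (X k)) [in RHS]lfunE /= (comulM gamma) gammaP.
by rewrite tpair_tens_mul.
Qed.

End Translation.

(** * Isomorphisms and adapted frames *)

Section Rebuild.
Variables (F : fieldType) (d : nat) (H K : hopfAlgType F).

Definition frame_map (V W : vectType F) (xi : nat -> 'Hom(V, F^o)) (Z : nat -> W) (v : V) : W :=
  \sum_(i <- idx d) xi i v *: Z i.

Lemma frame_map_is_linear (V W : vectType F) (xi : nat -> 'Hom(V, F^o)) (Z : nat -> W) :
  linear (frame_map xi Z).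
Proof.
move=> a u v; rewrite /frame_map scaler_sumr -big_split; apply: eq_bigr => i _.
by rewrite linearP scalerDl scalerA.
Qed.

HB.instance Definition _ (V W : vectType F) (xi : nat -> 'Hom(V, F^o)) (Z : nat -> W) :=
  GRing.isLinear.Build F V W *:%R (frame_map xi Z) (frame_map_is_linear xi Z).

Lemma frame_map_basis (V W : vectType F) X (xi : nat -> 'Hom(V, F^o)) (Z : nat -> W) :
  frame d X xi -> {in idx d, forall i, frame_map xi Z (X i) = Z i}.
Proof.
move=> fX i id; rewrite -(sum_deltal Z id); apply: eq_big_seq => a ad.
by rewrite (frame_dual fX).
Qed.

Lemma frame_mapK (V W : vectType F) X (xi : nat -> 'Hom(V, F^o)) Z (zeta : nat -> 'Hom(W, F^o)) :
  frame d X xi -> frame d Z zeta -> cancel (frame_map xi Z) (frame_map zeta X).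
Proof.
move=> fX fZ v; rewrite [frame_map xi Z v]/frame_map linear_sum [RHS](frame_span fX).
by apply: eq_big_seq => i id; rewrite linearZ /= (frame_map_basis X fZ).
Qed.

(** The linear map [X i |-> Z i] respects products and coproducts by equality of the tables, unit
    and counit because both frames are adapted. *)
Lemma hopf_iso_of_tables X xi Z zeta :
  adapted d (H := H) X xi -> adapted d (H := K) Z zeta ->
  {in idx d & &, forall i j k, mul_tab X xi i j k = mul_tab Z zeta i j k} ->
  {in idx d & &, forall i j k, comul_tab X xi i j k = comul_tab Z zeta i j k} ->
  hopf_iso H K.
Proof.
move=> [fX X1 xi0] [fZ Z1 zeta0] eqm eqn.
pose f : {linear H -> K} := frame_map xi Z.
have fX_ := frame_map_basis Z fX.
have id0 : 0%N \in idx d by rewrite mem_iota.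
have f1 : f 1 = 1 by rewrite -X1 /f /= fX_.
have fM u v : f (u * v) = f u * f v.
  rewrite [u](frame_span fX) [v](frame_span fX) mulr_suml !linear_sum mulr_suml.
  apply: eq_big_seq => i id.  rewrite [in LHS]mulr_sumr [LHS]linear_sum [RHS]mulr_sumr.
  apply: eq_big_seq => j jd.
  rewrite !linearZ -!scalerAl -!scalerAr !linearZ /= !fX_ // scalerA mulrC -scalerA.
  congr (_ *: (_ *: _)); rewrite (mul_frame fX) (mul_frame fZ) linear_sum.
  apply: eq_big_seq => k kd.
  by rewrite linearZ /= fX_ // eqm.
pose fm := GRing.isMonoidMorphism.Build H K f (conj f1 fM).
pose g : {lrmorphism H -> K} := HB.pack (frame_map xi Z) fm.
exists g; split; first by exists (frame_map zeta X); apply: frame_mapK.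
split=> c /=; last first.
  rewrite {1}/frame_map -epsilonE linear_sum -[RHS]epsilonE -xi0.
  rewrite -(sum_delta (fun i => xi i c) id0); apply: eq_big_seq => i id.
  rewrite linearZ /= -zeta0 (frame_dual fZ) // eq_sym.
  exact: mulr_natr.
rewrite [frame_map xi Z c]/frame_map [in RHS](frame_span fX c) !linear_sum.
apply: eq_big_seq => k kd.
rewrite !linearZ; congr (_ *: _); rewrite /= (comul_frame fZ) (comul_frame fX).
rewrite !linear_sum; apply: eq_big_seq => i id; rewrite !linear_sum.
apply: eq_big_seq => j jd; rewrite !linearZ /= eqn // tens_mapE /= !fX_ //.
Qed.

End Rebuild.

Lemma bij_linear_inverse (F : fieldType) (U V : vectType F) (f : {linear U -> V}) :
  bijective f -> exists2 f' : 'Hom(V, U), cancel f f' & cancel f' f.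
Proof.
move=> [g fK gK]; have ker_f : lker (linfun f) == 0%VS.
  by apply/lker0P => u v; rewrite !lfunE => /(can_inj fK).
have fK' : cancel f (linfun f)^-1%VF by move=> u; rewrite -[f u]lfunE lker0_lfunK.
by exists (linfun f)^-1%VF => // v; rewrite -{1}[v]gK fK'.
Qed.

Section IsoTransport.
Variables (F : fieldType) (d : nat) (H K : hopfAlgType F).
Variables (X : nat -> H) (xi : nat -> 'Hom(H, F^o)).
Hypothesis adX : adapted d X xi.

(** The transported augmentation is only a character of [K]; a translation moves it to the
    counit. *)
Lemma alg_iso_adapted : alg_iso H K -> exists Z zeta,
  adapted d (H := K) Z zeta /\ (forall i j k, mul_tab Z zeta i j k = mul_tab X xi i j k).
Proof.
case: adX => fX X1 xi0 [f /bij_linear_inverse[f' fK f'K]].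
have fZ : frame d (fun i => f (X i)) (fun i => (xi i \o f')%VF).
  by apply: frame_transfer fX => //; apply: linearP.
have [||Z [zeta [adZ ZE]]] := adapted_translate fZ fZ.
- by rewrite X1 rmorph1.
- rewrite xi0; split=> [|x y]; rewrite !comp_lfunE !epsilonE.
    by rewrite -(rmorph1 f) fK counit1.
  by rewrite -{1}[x]f'K -{1}[y]f'K -rmorphM fK counitM.
exists Z, zeta; split=> // i j k; rewrite ZE /mul_tab.
by rewrite comp_lfunE -rmorphM fK.
Qed.

(** The image of 1 is only a grouplike element of [K]; [adapted_grouplike] moves it to 1. *)
Lemma coalg_iso_adapted : coalg_iso H K -> exists Z zeta,
  adapted d (H := K) Z zeta /\ (forall i j k, comul_tab Z zeta i j k = comul_tab X xi i j k).
Proof.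
case: adX => fX X1 xi0 [f [/bij_linear_inverse[f' fK f'K] [f_comul f_counit]]].
have fZ : frame d (fun i => f (X i)) (fun i => (xi i \o f')%VF).
  by apply: frame_transfer fX => //; apply: linearP.
have [||Z [zeta [adZ ZE]]] := adapted_grouplike fZ.
- by apply/lfunP=> y; rewrite xi0 comp_lfunE !epsilonE -{2}[y]f'K f_counit.
- by rewrite X1 f_comul comul1 tens_mapE.
exists Z, zeta; split=> // i j k; rewrite ZE /comul_tab f_comul tpair_map.
have compE (g : 'Hom(H, F^o)) : linfun ((g \o f')%VF \o f) = g.
  by apply/lfunP=> x; rewrite lfunE /= comp_lfunE fK.
by rewrite !compE.
Qed.

End IsoTransport.

Definition coord_fun (F : fieldType) (V : vectType F) n (b : n.-tuple V) i : V -> F^o :=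
  coord b i.

Fact coord_fun_is_linear F V n b i : linear (@coord_fun F V n b i).
Proof. exact: linearP. Qed.

HB.instance Definition _ (F : fieldType) (V : vectType F) n (b : n.-tuple V) i :=
  GRing.isLinear.Build F V F^o *:%R (@coord_fun F V n b i) (coord_fun_is_linear b i).

(** Since [H] is the direct sum of the line of 1 and the kernel of the counit, 1 followed by a basis
    of the kernel is a basis whose coordinate 0 is the counit. *)
Lemma adapted_exists (F : fieldType) (H : hopfAlgType F) d : \dim {:H} = d.+1 ->
  exists (X : nat -> H) xi, adapted d X xi.
Proof.
move=> dimH; pose K := lker (epsilon H); pose b := 1 :: vbasis K : seq H.
have eps1 : epsilon H 1 = 1 by rewrite epsilonE counit1.
have span_b : (<<b>> = fullv)%VS.
  apply/vspaceP=> v; rewrite memvf span_cons (span_basis (vbasisP K)).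
  rewrite -[v](subrK ((epsilon H v : F) *: 1)) addrC memv_add ?memvZ ?memv_line //.
  by rewrite memv_ker linearB linearZ /= eps1 [_ *: 1]mulr1 subrr.
have free_b : free b.
  rewrite /b free_cons (span_basis (vbasisP K)) (basis_free (vbasisP K)) andbT.
  by rewrite memv_ker eps1 oner_eq0.
have size_b : size b = d.+1.
  by rewrite -dimH -span_b; apply/esym/eqP.
pose bt : d.+1.-tuple H := Tuple (introT eqP size_b).
pose xi i : 'Hom(H, F^o) := linfun (coord_fun bt (inord i)).
exists (fun i => b`_i), xi; split=> //.
  split=> [i j | v].
    rewrite !mem_iota /= !add0n => id jd; rewrite lfunE /= -[LHS]/(coord bt (inord i) bt`_j).
    by rewrite -(inordK jd) coord_free // eq_sym -(inj_eq val_inj) /= !inordK.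
  have /coord_span {1}-> : v \in <<bt>>%VS by rewrite span_b memvf.
  rewrite [idx d](_ : _ = index_iota 0 d.+1) // big_mkord; apply: eq_bigr => i _.
  by rewrite lfunE /= /coord_fun inord_val.
apply/lfunP=> v; rewrite lfunE /= -[LHS]/(coord bt (inord 0) v).
have /coord_span vE : v \in <<bt>>%VS by rewrite span_b memvf.
rewrite [in RHS]vE linear_sum big_ord_recl big1 => [|i _].
  rewrite linearZ /= eps1 addr0 [inord 0](_ : _ = ord0); first exact/esym/mulr1.
  by apply: val_inj; rewrite /= inordK.
rewrite linearZ /=; have /eqP-> : epsilon H (vbasis K)`_i == 0.
  rewrite -memv_ker; apply: vbasis_mem; apply: mem_nth.
  by have [->] := size_b.
exact: mulr0.
Qed.

(** * Tables over F_2 *)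

Lemma F2_inj (a b : bool) : a%:R = b%:R :> 'F_2 -> a = b.
Proof. by case: a b => [] []. Qed.

Lemma F2_neq0 (x : 'F_2) : (x != 0)%:R = x.
Proof. by case: x => [[|[|]]] // ?; apply/val_inj. Qed.

Lemma F2_add (a b : bool) : (a (+) b)%:R = a%:R + b%:R :> 'F_2.
Proof. by case: a b => [] []; apply/val_inj. Qed.

Lemma F2_mul (a b : bool) : (a && b)%:R = a%:R * b%:R :> 'F_2.
Proof. by rewrite -natrM mulnb. Qed.

Lemma F2_sum (I : Type) (r : seq I) (f : I -> bool) :
  (xsum [seq f i | i <- r])%:R = \sum_(i <- r) (f i)%:R :> 'F_2.
Proof. by elim: r => [|i r IH]; rewrite ?big_nil // big_cons -IH -F2_add. Qed.

Lemma F2_xrebase d g h t i j k : (xrebase d g h t i j k)%:R =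
  rebase_tab d (fun i j => (g i j)%:R) (fun i j => (h i j)%:R) (fun i j k => (t i j k)%:R)
    i j k :> 'F_2.
Proof.
rewrite xrebaseE (big_morph (fun b : bool => b%:R : 'F_2) F2_add (erefl _)).
apply: eq_bigr => a _; rewrite (big_morph _ F2_add (erefl _)).
apply: eq_bigr => b _; rewrite (big_morph _ F2_add (erefl _)).
by apply: eq_bigr => c _; rewrite !F2_mul.
Qed.

Lemma eq_rebase_tab (F : fieldType) d (g h : nat -> nat -> F) t u :
  {in idx d & &, forall i j k, t i j k = u i j k} ->
  forall i j k, rebase_tab d g h t i j k = rebase_tab d g h u i j k.
Proof.
move=> tu i j k; apply: eq_big_seq => a ad; apply: eq_big_seq => b bd.
by apply: eq_big_seq => c cd; rewrite tu.
Qed.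

Section Tables.
Variables (d : nat) (H : hopfAlgType 'F_2).
Local Notation d0 := (mem_head 0%N (iota 1 d)).

Definition represents (f : nat -> nat -> nat -> 'F_2) (t : nat -> nat -> nat -> bool) :=
  {in idx d & &, forall i j k, f i j k = (t i j k)%:R}.

Definition alg_table t := exists X xi,
  adapted d (H := H) X xi /\ represents (mul_tab X xi) t.
Definition coalg_table t := exists X xi,
  adapted d (H := H) X xi /\ represents (comul_tab X xi) t.
Definition hopf_table t u := exists X xi,
  [/\ adapted d (H := H) X xi, represents (mul_tab X xi) t & represents (comul_tab X xi) u].

Lemma represents_bits f : represents f (fun i j k => f i j k != 0).
Proof. by move=> i j k _ _ _; rewrite F2_neq0. Qed.

Lemma represents_xrebase f g h t X :
  represents f t -> represents X (xrebase d g h t) <->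
  {in idx d & &, forall i j k,
     X i j k = rebase_tab d (fun i j => (g i j)%:R) (fun i j => (h i j)%:R) f i j k}.
Proof.
move=> ft; split=> E i j k id jd kd; rewrite E // F2_xrebase; last symmetry;
  by apply: eq_rebase_tab => a b c ad bd cd; rewrite ft.
Qed.

Lemma inverse_pair_F2 g h : inverse_pair d g h ->
  {in idx d &, forall i k, \sum_(a <- idx d) (g i a)%:R * (h a k)%:R = (i == k)%:R :> 'F_2}.
Proof.
move=> /agree2P gh i k id kd; rewrite -gh // F2_sum.
by apply: eq_bigr => a _; rewrite F2_mul.
Qed.

Lemma inverse_pair_tr g h : inverse_pair d g h ->
  inverse_pair d (fun i j => h j i) (fun i j => g j i).
Proof.
move=> /agree2P gh; apply/agree2P => i k id kd; rewrite eq_sym -gh //.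
by apply: eq_xsum => a _; rewrite andbC.
Qed.

Lemma base_change_tr g h : base_change d g h ->
  base_change d (fun i j => h j i) (fun i j => g j i).
Proof.
move=> /and3P[gh hg /andP[/andP[g0 g0'] /andP[h0 h0']]].
by apply/and4P; split; try exact: inverse_pair_tr; apply/andP.
Qed.

Lemma sum_pointed (V : lmodType 'F_2) (p : nat -> bool) (f : nat -> V) :
  agree1 d p (eq_op 0%N) -> \sum_(a <- idx d) (p a)%:R *: f a = f 0%N.
Proof.
move=> /agree1P p0; rewrite -[RHS](sum_deltal f d0); apply: eq_big_seq => a ad.
by rewrite p0 // eq_sym.
Qed.

Section Change.
Variables (X : nat -> H) (xi : nat -> 'Hom(H, ('F_2)^o)).
Hypothesis adX : adapted d X xi.
Variables (g h : nat -> nat -> bool).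
Hypotheses (gh : inverse_pair d g h) (hg : inverse_pair d h g).

Definition new_basis i := \sum_(a <- idx d) ((g i a)%:R : 'F_2) *: X a.
Definition new_dual k := \sum_(c <- idx d) ((h c k)%:R : 'F_2) *: xi c.

Lemma frame_new : frame d new_basis new_dual.
Proof. by case: adX => fX _ _; apply: frame_change => //; apply: inverse_pair_F2. Qed.

Lemma new_dual_basis c k : c \in idx d -> new_dual k (X c) = (h c k)%:R.
Proof.
case: adX => fX _ _ cd; rewrite sum_lfunE -(sum_delta (fun c => (h c k)%:R) cd).
by apply: eq_big_seq => a ad; rewrite scale_lfunE (frame_dual fX) //; apply: mulr_natr.
Qed.

Lemma dual_new_basis i k : k \in idx d -> xi k (new_basis i) = (g i k)%:R.
Proof.
case: adX => fX _ _ kd; rewrite linear_sum -(sum_delta (fun k => (g i k)%:R) kd).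
apply: eq_big_seq => a ad; rewrite linearZ /= (frame_dual fX) // eq_sym; exact: mulr_natr.
Qed.

Lemma represents_mul_new t : represents (mul_tab X xi) t ->
  represents (mul_tab new_basis new_dual) (xrebase d g h t).
Proof.
move=> Xt; apply/(represents_xrebase _ _ _ Xt) => i j k _ _ _.
exact: mul_tab_rebase.
Qed.

Lemma represents_comul_new t : represents (comul_tab X xi) t ->
  represents (comul_tab new_basis new_dual) (xrebase d (fun i j => h j i) (fun i j => g j i) t).
Proof.
move=> Xt; apply/(represents_xrebase _ _ _ Xt) => i j k _ _ _.
exact: (comul_tab_rebase (g := fun i j => (g i j)%:R) (h := fun i j => (h i j)%:R)).
Qed.

Lemma adapted_new : pointed d g -> pointed d h -> adapted d new_basis new_dual.
Proof.
case: adX => fX X1 xi0 /andP[g0 _] /andP[_ h0]; split; first exact: frame_new.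
  by rewrite /new_basis sum_pointed.
by rewrite /new_dual sum_pointed.
Qed.

End Change.

Lemma F2_neq0_nat (b : bool) : ((b%:R : 'F_2) != 0) = b.
Proof. by case: b. Qed.

Lemma frame_expand (X : nat -> H) xi (eta : 'Hom(H, ('F_2)^o)) v : frame d X xi ->
  \sum_(a <- idx d) xi a v * eta (X a) = eta v.
Proof.
move=> fX; rewrite [in RHS](frame_span fX v) linear_sum.
by apply: eq_bigr => a _; rewrite linearZ.
Qed.

Lemma inverse_pair_frames (X Y : nat -> H) xi eta : frame d X xi -> frame d Y eta ->
  inverse_pair d (fun i a => xi a (Y i) != 0) (fun c k => eta k (X c) != 0).
Proof.
move=> fX fY; apply/agree2P=> i k id kd; apply: F2_inj.
rewrite F2_sum eq_sym -(frame_dual fY) // -(frame_expand _ _ fX).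
by apply: eq_bigr => a _; rewrite F2_mul !F2_neq0.
Qed.

Lemma pointed_frames (X Y : nat -> H) xi eta : adapted d X xi -> adapted d Y eta ->
  pointed d (fun i a => xi a (Y i) != 0).
Proof.
move=> [fX X1 xi0] [fY Y1 eta0]; apply/andP; split; apply/agree1P=> a ad.
  by rewrite Y1 -X1 (frame_dual fX) // F2_neq0_nat eq_sym.
by rewrite xi0 -eta0 (frame_dual fY) // F2_neq0_nat.
Qed.

(** The matrices hold the coordinates of each frame in the other; over F_2 a coordinate is recovered
    from whether it is nonzero. *)
Lemma adapted_base_change X xi Y eta :
  adapted d (H := H) X xi -> adapted d (H := H) Y eta ->
  exists g h, [/\ base_change d g h,
    forall i, Y i = new_basis X g i & forall k, eta k = new_dual xi h k].
Proof.
move=> adX adY; have [[fX _ _] [fY _ _]] := (adX, adY).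
exists (fun i a => xi a (Y i) != 0), (fun c k => eta k (X c) != 0); split.
- apply/and4P; split; try exact: inverse_pair_frames.
  + exact: pointed_frames adX adY.
  + exact: pointed_frames adY adX.
- move=> i; rewrite {1}[Y i](frame_span fX); apply: eq_bigr => a _.
  by rewrite F2_neq0.
- move=> k; rewrite {1}(frame_lfun (eta k) fX); apply: eq_bigr => a _.
  by rewrite F2_neq0.
Qed.

Lemma character_new X xi t h : adapted d (H := H) X xi -> represents (mul_tab X xi) t ->
  is_character d (h^~ 0%N) t -> forall x y,
  new_dual xi h 0 (x * y) = new_dual xi h 0 x * new_dual xi h 0 y.
Proof.
move=> adX Xt /agree2P hP x y; have [fX _ _] := adX; set chi := new_dual xi h 0%N.
have chiX c : c \in idx d -> chi (X c) = (h c 0)%:R by apply: new_dual_basis.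
rewrite [x](frame_span fX) [y](frame_span fX) mulr_suml !linear_sum mulr_suml.
apply: eq_big_seq => i id; rewrite [in LHS]mulr_sumr [LHS]linear_sum [RHS]mulr_sumr.
apply: eq_big_seq => j jd; rewrite -scalerAl -scalerAr !linearZ /= !chiX //.
rewrite -[RHS]/((xi i x * (h i 0)%:R) * (xi j y * (h j 0)%:R)).
rewrite mulrACA -F2_mul hP // F2_sum (mul_frame fX) linear_sum.
rewrite -[LHS]/(xi i x * (xi j y * _)) mulrA; congr (_ * _); apply: eq_big_seq => k kd.
by rewrite linearZ /= chiX // Xt // F2_mul mulrC.
Qed.

Lemma alg_table_family : table_family d alg_table.
Proof.
split.
- move=> t u tu [X [xi [adX Xt]]]; exists X, xi; split=> // i j k id jd kd.
  by rewrite Xt // tu.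
- move=> t [X [xi [[fX X1 xi0] Xt]]] j k jd kd; split; apply: F2_inj.
  + by rewrite -Xt ?d0 // /mul_tab X1 mul1r (frame_dual fX) // eq_sym.
  + by rewrite -Xt ?d0 // /mul_tab X1 mulr1 (frame_dual fX) // eq_sym.
  + rewrite -Xt ?d0 // /mul_tab xi0 epsilonE counitM -!epsilonE -xi0.
    by rewrite !(frame_dual fX) ?d0 // F2_mul.
- move=> t [X [xi [[fX X1 xi0] Xt]]] i j k l id jd kd ld; apply: F2_inj.
  have := mul_tabA fX i j k l; rewrite !F2_sum => E.
  transitivity (\sum_(a <- idx d) mul_tab X xi i j a * mul_tab X xi a k l).
    by apply: eq_big_seq => a ad; rewrite F2_mul !Xt.
  by rewrite E; apply: eq_big_seq => a ad; rewrite F2_mul !Xt.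
- move=> t g h [X [xi [adX Xt]]] /and4P[gh hg g0 hP]; have [fX X1 xi0] := adX.
  have fZ := frame_new adX gh hg.
  have Z1 : new_basis X g 0 = 1 by rewrite /new_basis sum_pointed.
  (* The new augmentation is a character that may differ from the counit; translating by it restores
     an adapted frame with the same table. *)
  have [|Z [zeta [adZ ZE]]] := adapted_translate fZ fZ Z1.
    split; last exact: (character_new adX Xt hP).
    by rewrite -Z1; apply: (frame_dual fZ d0 d0).
  exists Z, zeta; split=> // i j k id jd kd; rewrite ZE.
  exact: represents_mul_new.
- move=> t u [X [xi [adX Xt]]] [Y [eta [adY Yu]]].
  have [g [h [gh_bc Yg etah]]] := adapted_base_change adX adY.
  exists g, h; split=> // i j k id jd kd; apply: F2_inj; rewrite -Yu //.
  have [fX _ _] := adX.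
  rewrite F2_xrebase [RHS](mul_tab_rebase (xi := xi) (g := fun i j => (g i j)%:R)
    (h := fun i j => (h i j)%:R) (Yg i) (Yg j) (etah k)).
  by symmetry; apply: eq_rebase_tab.
Qed.

End Tables.

(** * Comultiplication tables and Hopf tables *)

Section HopfTables.
Variables (d : nat) (H : hopfAlgType 'F_2).
Local Notation d0 := (mem_head 0%N (iota 1 d)).

Lemma coalg_table_family : table_family d (coalg_table d H).
Proof.
split.
- move=> t u tu [X [xi [adX Xt]]]; exists X, xi; split=> // i j k id jd kd.
  by rewrite Xt // tu.
- move=> t [X [xi [[fX X1 xi0] Xt]]] j k jd kd; split; apply: F2_inj.
  + by rewrite -Xt ?d0 // /comul_tab xi0 tpair_counitl (frame_dual fX).
  + by rewrite -Xt ?d0 // /comul_tab xi0 tpair_counitr (frame_dual fX).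
  + rewrite -Xt ?d0 // /comul_tab X1 comul1 tpairE -X1.
    by rewrite !(frame_dual fX) ?d0 // F2_mul eq_sym [k == _]eq_sym.
- move=> t [X [xi [[fX X1 xi0] Xt]]] i j k l id jd kd ld; apply: F2_inj.
  have := comul_tabA fX i j k l; rewrite !F2_sum => E.
  transitivity (\sum_(a <- idx d) comul_tab X xi i j a * comul_tab X xi a k l).
    by apply: eq_big_seq => a ad; rewrite F2_mul !Xt.
  by rewrite E; apply: eq_big_seq => a ad; rewrite F2_mul !Xt.
- move=> t g h [X [xi [adX Xt]]] /and4P[gh hg g0 /agree2P hP]; have [fX X1 xi0] := adX.
  (* Comultiplication tables transform contragrediently, so the basis changes by the transpose of
     [h]. *)
  have [gh' hg'] := (inverse_pair_tr gh, inverse_pair_tr hg).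
  have fZ := frame_new adX gh' hg'.
  have [||Z [zeta [adZ ZE]]] := adapted_grouplike fZ.
  + by rewrite /new_dual sum_pointed.
  (* The character condition on column 0 of [h] says here that the new basis vector 0 is
     grouplike. *)
  + rewrite {1}/new_basis linear_sum.
    rewrite (bilin_frame fX fX _ _ (bilin_tens H H)).
    transitivity (\sum_(c <- idx d) \sum_(i <- idx d) \sum_(j <- idx d)
       ((h c 0)%:R * (t i j c)%:R) *: tens (X i) (X j)).
      apply: eq_big_seq => c cd; rewrite linearZ /= (comul_frame fX) scaler_sumr.
      apply: eq_big_seq => i id; rewrite scaler_sumr; apply: eq_big_seq => j jd.
      by rewrite scalerA Xt.
    rewrite exchange_big; apply: eq_big_seq => i id /=.
    rewrite exchange_big; apply: eq_big_seq => j jd /=.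
    rewrite -scaler_suml !(dual_new_basis adX) //; congr (_ *: _).
    rewrite -F2_mul hP // F2_sum; apply: eq_bigr => c _; exact/esym/F2_mul.
  exists Z, zeta; split=> // i j k id jd kd; rewrite ZE.
  exact: (@represents_comul_new _ _ _ _ (fun i j => h j i) (fun i j => g j i) _ Xt).
- move=> t u [X [xi [adX Xt]]] [Y [eta [adY Yu]]].
  have [g [h [gh_bc Yg etah]]] := adapted_base_change adX adY.
  exists (fun i j => h j i), (fun i j => g j i); split; first exact: base_change_tr.
  move=> i j k id jd kd; apply: F2_inj; rewrite -Yu //.
  have [fX _ _] := adX.
  rewrite F2_xrebase [RHS](comul_tab_rebase (xi := xi) (g := fun i j => (g i j)%:R)
    (h := fun i j => (h i j)%:R) (Yg k) (etah i) (etah j)).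
  by symmetry; apply: eq_rebase_tab.
Qed.

Lemma hopf_table_rebase m c g h : hopf_table d H m c -> base_change d g h ->
  hopf_table d H (xrebase d g h m) (xrebase d (fun i j => h j i) (fun i j => g j i) c).
Proof.
move=> [X [xi [adX Xm Xc]]] /and4P[gh hg g0 h0].
exists (new_basis d X g), (new_dual d xi h); split.
- exact: adapted_new.
- exact: represents_mul_new.
- exact: represents_comul_new.
Qed.

Lemma hopf_table_compatible m c : hopf_table d H (entry m) (entry c) ->
  compatible d m (with_cosupports d c).
Proof.
move=> [X [xi [[fX X1 xi0] Xm Xc]]].
have comp i j p q : i \in idx d -> j \in idx d -> p \in idx d -> q \in idx d ->
    compatible_at d m (with_cosupports d c) i j p q.
  move=> id jd pd qd; rewrite /compatible_at negb_add [_.1]/=.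
  rewrite -[_.2]/[seq cosupport d c k | k <- idx d] !nth_tab //; apply/eqP.
  apply: F2_inj; rewrite F2_sum.
  transitivity (\sum_(k <- idx d) mul_tab X xi i j k * comul_tab X xi p q k).
    by apply: eq_big_seq => k kd; rewrite F2_mul Xm // Xc.
  rewrite (mul_comul_tab fX) xsumE big_allpairs_dep big_filter big_mkcond big_allpairs_dep /=.
  rewrite (big_morph (fun b : bool => b%:R : 'F_2) F2_add (erefl _)).
  apply: eq_big_seq => a ad; rewrite (big_morph _ F2_add (erefl _)).
  (* Pairs outside the cosupport contribute 0. *)
  apply: eq_big_seq => b bd; case: ifP => [ab|/negbT ab]; last first.
    rewrite big1 // => e _; rewrite big1 // => f _.
    by rewrite Xc // (negPf ab) mul0r.
  rewrite /cosupport big_filter [in RHS]big_mkcond [in RHS]big_allpairs_dep /=.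
  rewrite (big_morph _ F2_add (erefl _)).
  apply: eq_big_seq => e ed; rewrite (big_morph _ F2_add (erefl _)).
  apply: eq_big_seq => f fd; rewrite Xc // ab mul1r Xc // !Xm //.
  by case: ifP => _; rewrite ?mul0r ?mul1r // F2_mul.
have posP i : i \in iota 1 d -> i \in idx d by rewrite inE orbC => ->.
have everyP (s : seq nat) (b : pred nat) : {in s, forall i, b i} -> every b s.
  by rewrite everyE => sb; apply/allP.
rewrite /compatible everyP => [|i /posP id]; last first.
  by apply: (everyP) => j; rewrite mem_rev => /posP jd; exact: comp.
apply: (everyP) => p /posP pd; apply: (everyP) => q /posP qd; apply: (everyP) => i /posP id.
by apply: (everyP) => j; rewrite mem_rev => /posP jd; exact: comp.
Qed.

Lemma hopf_table_antipode m c : hopf_table d H (entry m) (entry c) ->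
  has_antipode d m (with_cosupports d c).
Proof.
move=> [X [xi [[fX X1 xi0] Xm Xc]]].
(* The coordinates of the actual antipode, numbered as in [antipode_polys]; the base is [d.+1]
   because index 0 takes part. *)
pose s n := xi (n %% d.+1)%N (antipode (X (n %/ d.+1)%N)) != 0.
suff /mem_solve : all (fun p => ~~ ev (mkseq s (d.+1 * d.+1)) p)
    (antipode_polys d m (with_cosupports d c)).
  by rewrite size_mkseq /has_antipode; case: (solve _ _).
rewrite all_allpairs; apply/allP=> k kd; apply/allP=> p pd.
rewrite ev_add ev_sum negb_add; apply/eqP; apply: F2_inj.
have d0 : 0%N \in idx d by rewrite mem_head.
transitivity (counit (X k) * xi p 1); last rewrite -(antipode_tab fX kd pd).
  rewrite -epsilonE -xi0 -X1 !(frame_dual fX) // F2_mul.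
  by rewrite eq_sym.
rewrite map_allpairs -[_.2]/[seq cosupport d c k | k <- idx d] nth_tab // xsumE.
rewrite big_allpairs_dep /= big_filter [in RHS]big_mkcond [in RHS]big_allpairs_dep.
rewrite (big_morph (fun b : bool => b%:R : 'F_2) F2_add (erefl _)).
apply: eq_big_seq => i id; rewrite (big_morph _ F2_add (erefl _)).
apply: eq_big_seq => j jd /=; case: ifP => [cE|/negbT cE]; last first.
  by rewrite big1 // => a _; rewrite Xc // (negPf cE) mul0r.
rewrite /support_of big_filter [in RHS]big_mkcond (big_morph _ F2_add (erefl _)).
apply: eq_big_seq => a ad; rewrite Xc // cE mul1r Xm //.
case: ifP => _; rewrite ?mul0r ?mul1r // nth_mkseq; last by move: id ad; rewrite !mem_idx; nia.
have ltad : (a < d.+1)%N by rewrite ltnS -mem_idx.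
by rewrite /s modnMDl divnMDl // modn_small // divn_small // addn0 F2_neq0.
Qed.

End HopfTables.

(** In a frame with multiplication table [m], the comultiplication table lies in the orbit of [n]; a
    base change stabilizing [m] turns it into [c0], chosen before [H]. *)
Lemma rigid_hopf_table d m n : rigid d -> m \in normal_forms d (GL d) ->
  n \in normal_forms d (GL d) ->
  exists c0, forall H : hopfAlgType 'F_2,
    alg_table d H (entry m) -> coalg_table d H (entry n) -> hopf_table d H (entry m) (entry c0).
Proof.
move=> rig mM nM; have [c0 c0P] := rigid_conjugate rig mM nM.
exists c0 => H [X [xi [adX Xm]]] Hn.
have Ht : coalg_table d H (fun i j k => comul_tab X xi i j k != 0).
  by exists X, xi; split=> //; apply: represents_bits.
have [c cO cE] := orbit_complete (coalg_table_family d H) Hn Ht.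
have Hmc : hopf_table d H (entry m) (entry c).
  by exists X, xi; split=> // i j k id jd kd; rewrite cE // F2_neq0.
have [g [h [gh mE c0E]]] := c0P c cO (hopf_table_compatible Hmc) (hopf_table_antipode Hmc).
have [Z [zeta [adZ Zm Zc]]] := hopf_table_rebase Hmc gh.
by exists Z, zeta; split=> // i j k id jd kd; rewrite (Zm, Zc) // (mE, c0E).
Qed.

(** The normal forms [m] and [n] found for [H] pass to [K] along the two isomorphisms, so both
    algebras acquire the tables [m] and [c0]. *)
Lemma rigid_hopf_iso d (H K : hopfAlgType 'F_2) : rigid d ->
  \dim {:H} = d.+1 -> alg_iso H K -> coalg_iso H K -> hopf_iso H K.
Proof.
move=> rig /adapted_exists[X [xi adX]] algHK coalgHK.
have Ha : alg_table d H (fun i j k => mul_tab X xi i j k != 0).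
  by exists X, xi; split=> //; apply: represents_bits.
have Hc : coalg_table d H (fun i j k => comul_tab X xi i j k != 0).
  by exists X, xi; split=> //; apply: represents_bits.
have [m mM Hm] := normal_forms_complete (alg_table_family d H) Ha.
have [n nM Hn] := normal_forms_complete (coalg_table_family d H) Hc.
have Km : alg_table d K (entry m).
  have [Y [eta [adY Ym]]] := Hm; have [Z [zeta [adZ ZE]]] := alg_iso_adapted adY algHK.
  by exists Z, zeta; split=> // i j k id jd kd; rewrite ZE Ym.
have Kn : coalg_table d K (entry n).
  have [Y [eta [adY Yn]]] := Hn; have [Z [zeta [adZ ZE]]] := coalg_iso_adapted adY coalgHK.
  by exists Z, zeta; split=> // i j k id jd kd; rewrite ZE Yn.
have [c0 c0P] := rigid_hopf_table rig mM nM.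
have [[Y [eta [adY Ym Yc]]] [Z [zeta [adZ Zm Zc]]]] := (c0P H Hm Hn, c0P K Km Kn).
apply: (hopf_iso_of_tables adY adZ) => i j k id jd kd; first by rewrite Ym // Zm.
by rewrite Yc // Zc.
Qed.

(** * Composition of isomorphisms and the finite check *)

Lemma alg_iso_sym (F : fieldType) (A B : falgType F) : alg_iso A B -> alg_iso B A.
Proof.
move=> [f [g fK gK]].
have g_lin : linear g := can2_linear fK gK.
have g_mon : monoid_morphism g := can2_monoid_morphism fK gK.
pose gl := GRing.isLinear.Build F B A *:%R g g_lin.
pose gm := GRing.isMonoidMorphism.Build B A g g_mon.
pose gL : {lrmorphism B -> A} := HB.pack g gl gm.
by exists gL, f.
Qed.

Lemma alg_iso_trans (F : fieldType) (A B C : falgType F) :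
  alg_iso A B -> alg_iso B C -> alg_iso A C.
Proof.
move=> [f f_bij] [g g_bij]; exists (g \o f : {lrmorphism A -> C}).
exact: bij_comp g_bij f_bij.
Qed.

Lemma coalg_iso_sym (F : fieldType) (A B : coalgType F) : coalg_iso A B -> coalg_iso B A.
Proof.
move=> [f [[g fK gK] [f_comul f_counit]]].
have g_lin : linear g := can2_linear fK gK.
pose gl := GRing.isLinear.Build F B A *:%R g g_lin.
pose gL : {linear B -> A} := HB.pack g gl.
exists gL; split; first by exists f.
split=> b /=; last by rewrite -{2}[b]gK f_counit.
rewrite -{2}[b]gK f_comul.
have E : tens_map gL gL \o tens_map f f =1 idfun.
  apply: tens_ext => u v; rewrite -[LHS]/(tens_map gL gL (tens_map f f (tens u v))).
  by rewrite !tens_mapE -[gL (f u)]/(g (f u)) -[gL (f v)]/(g (f v)) !fK.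
by rewrite -[RHS]/((tens_map gL gL \o tens_map f f) _) E.
Qed.

Lemma coalg_iso_trans (F : fieldType) (A B C : coalgType F) :
  coalg_iso A B -> coalg_iso B C -> coalg_iso A C.
Proof.
move=> [f [f_bij [f_comul f_counit]]] [g [g_bij [g_comul g_counit]]].
exists (g \o f : {linear A -> C}); split; first exact: bij_comp g_bij f_bij.
split=> a /=; last by rewrite g_counit f_counit.
rewrite g_comul f_comul.
have E : tens_map g g \o tens_map f f =1 tens_map (g \o f) (g \o f).
  by apply: tens_ext => u v; rewrite /= !tens_mapE.
exact: E.
Qed.

Lemma rigid_le3 d : (d <= 3)%N -> rigid d.
Proof.
case: d => [|[|[|[|d]]]] d_le3; last by case: (notF d_le3).
(* The four computations settle dimensions 1 to 4, as [d] is one less than the dimension. *)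
all: by vm_compute.
Qed.

Theorem proposition4p3 (n : nat) (H H' : hopfAlgType 'F_2)
    (n_le4 : (n <= 4)%N) (dimH : \dim {:H} = n) (dimH' : \dim {:H'} = n) :
  (forall X Y : falgType 'F_2,
     has_algcoalg_type H X Y -> has_algcoalg_type H' X Y -> hopf_iso H H') /\
  (alg_iso H H' -> coalg_iso H H' -> hopf_iso H H').
Proof.
have main : alg_iso H H' -> coalg_iso H H' -> hopf_iso H H'.
  case: n n_le4 dimH {dimH'} => [_ /eqP|d d_le3].
    (* Dimension 0 is impossible because 1 is nonzero in [H]. *)
    by rewrite dimv_eq0 => /eqP H0; have := memvf (1 : H); rewrite H0 memv0 oner_eq0.
  exact/rigid_hopf_iso/rigid_le3.
(* A common type yields isomorphisms from [H] to [H'] through [X] and through [dual Y]. *)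
split=> // X Y [HX HY] [H'X H'Y]; apply: main.
  exact: alg_iso_trans HX (alg_iso_sym H'X).
exact: coalg_iso_trans HY (coalg_iso_sym H'Y).
Qed.
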